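(* Let $V_1,V_2$ be finite-dimensional complex superspaces with $\dim V_i=N_i=m_i+n_i\varepsilon$ and $N_i\neq1$, $\varepsilon$, $1+\varepsilon$ for $i=1,2$. Let $V=V_1\otimes V_2$. Then: 1) $\mathfrak{gl}(V_1)\odot\mathfrak{gl}(V_2)$ is a maximal subalgebra of $\mathfrak{gl}(V)$ if $n_1\neq m_1$ or $n_2\neq m_2$; otherwise it is maximal in $\mathfrak{sl}(V)$. 2) The following subalgebras are maximal in $\mathfrak{sl}(V)$: a) $\mathfrak{sl}(V_1)\oplus\mathfrak{sl}(V_2)$ if $n_1\neq m_1$ or $n_2\neq m_2$; b) $\mathfrak{gl}(V_1)\odot\mathfrak{gl}(V_2)$ if $n_1=m_1$ and $n_2=m_2$.
   Context: The superdimension of $V=V_{\bar0}\oplus V_{\bar1}$ is written $\dim V=\dim V_{\bar0}+\varepsilon\dim V_{\bar1}$, $\varepsilon^2=1$. $\mathfrak{gl}(V)$ is the Lie superalgebra of all linear operators on $V$ (with supercommutator), $\mathfrak{sl}(V)$ the subalgebra of operators with zero supertrace. For $\mathfrak g_i\subset\mathfrak{gl}(V_i)$, the sum $\mathfrak g_1\oplus\mathfrak g_2$ acts on $V_1\otimes V_2$ by $X_1+X_2\mapsto X_1\otimes1+1\otimes X_2$, and $\mathfrak g_1\odot\mathfrak g_2\subset\mathfrak{gl}(V_1\otimes V_2)$ denotes the image (the map has a one-dimensional kernel if both $\mathfrak g_i$ contain the identity); $\mathfrak{sl}(V_1)\oplus\mathfrak{sl}(V_2)$ is regarded as a subalgebra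 of $\mathfrak{gl}(V_1\otimes V_2)$ through this action. ''Subalgebra'' means Lie subsuperalgebra; maximal means proper and not contained in a strictly larger proper subalgebra. *)

(* Defs.v *)
From HB Require Import structures.
From mathcomp Require Import all_boot all_order all_algebra.
From mathcomp Require Import reals complex.

Set Implicit Arguments.
Unset Strict Implicit.
Unset Printing Implicit Defensive.

Import Order.TTheory GRing.Theory Num.Theory.
Import passmx.
Local Open Scope ring_scope.

(* Parities live in bool: false is \bar 0, true is \bar 1, and addb is their
   addition in Z/2. *)
Record superspace (F : fieldType) := Superspace {
  carrier :> vectType F;
  part : bool -> {vspace carrier};
  part_full : (part false + part true = fullv)%VS;
  part_direct : (part false :&: part true = 0)%VS }.

(* The pair (m, n) stands for m + n epsilon. *)
Definition sdim (F : fieldType) (V : superspace F) : nat * nat :=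
  (\dim (part V false), \dim (part V true)).

Definition proj (F : fieldType) (V : superspace F) (p : bool) : 'End(V) :=
  daddv_pi (part V p) (part V (~~ p)).

(* The component of f of parity p: it sends part V q to part V (p (+) q). *)
Definition hcomp (F : fieldType) (V : superspace F) (p : bool) (f : 'End(V))
  : 'End(V) :=
  \sum_(q : bool) (proj V (p (+) q) \o f \o proj V q)%VF.

Definition sbracket (F : fieldType) (V : superspace F) (f g : 'End(V))
  : 'End(V) :=
  \sum_(p : bool) \sum_(q : bool)
    ((hcomp p f \o hcomp q g)%VF
     - (-1) ^+ (p && q) *: (hcomp q g \o hcomp p f)%VF).

Definition lftrace (F : fieldType) (V : vectType F) (f : 'End(V)) : F :=
  \tr (mxof (vbasis {:V}) (vbasis {:V}) f).

Definition strace (F : fieldType) (V : superspace F) (f : 'End(V)) : F^o :=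
  lftrace (proj V false \o f \o proj V false)
  - lftrace (proj V true \o f \o proj V true).

Lemma strace_linear (F : fieldType) (V : superspace F) :
  linear (@strace F V).
Proof.
move=> a f g; rewrite /strace /lftrace.
rewrite !(comp_lfunDr, comp_lfunDl) -!(comp_lfunZr, comp_lfunZl).
rewrite !linearD !linearZ /= opprD addrACA; congr (_ + _).
by rewrite scalerN.
Qed.

HB.instance Definition _ (F : fieldType) (V : superspace F) :=
  GRing.isSemilinear.Build F _ _ _ (@strace F V)
    (GRing.semilinear_linear (@strace_linear F V)).

Definition gl (F : fieldType) (V : superspace F) : {vspace 'End(V)} := fullv.

Definition sl (F : fieldType) (V : superspace F) : {vspace 'End(V)} :=
  lker (linfun (@strace F V)).

Lemma mem_sl (F : fieldType) (V : superspace F) (f : 'End(V)) :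
  (f \in sl V) = (strace f == 0).
Proof. by rewrite memv_ker lfunE. Qed.

Definition lie_subsuperalgebra (F : fieldType) (V : superspace F)
    (L : {vspace 'End(V)}) : Prop :=
  (forall p f, f \in L -> hcomp p f \in L) /\
  (forall f g, f \in L -> g \in L -> sbracket f g \in L).

Definition maximal_subalgebra (F : fieldType) (V : superspace F)
    (M L : {vspace 'End(V)}) : Prop :=
  [/\ lie_subsuperalgebra M, (M <= L)%VS, M <> L &
      forall K : {vspace 'End(V)}, lie_subsuperalgebra K ->
        (M <= K)%VS -> (K <= L)%VS -> K = M \/ K = L].

Section TensorSpace.
Variables (F : fieldType) (V1 V2 : vectType F).

(* An element of V1 (x) V2 is represented by the matrix of its coordinates on
   the products of the vectors of two bases. *)
Definition tensor_space : vectType F := 'M[F]_(\dim {:V1}, \dim {:V2}).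

Definition tens (x : V1) (y : V2) : tensor_space :=
  (rVof (vbasis {:V1}) x)^T *m rVof (vbasis {:V2}) y.

Definition tens_lift_fun (W : vectType F) (b : V1 -> V2 -> W)
    (M : tensor_space) : W :=
  \sum_i \sum_j M i j *: b (vbasis {:V1})`_i (vbasis {:V2})`_j.

Lemma tens_lift_linear (W : vectType F) (b : V1 -> V2 -> W) :
  linear (tens_lift_fun b).
Proof.
move=> a M N; rewrite /tens_lift_fun scaler_sumr -big_split /=.
apply: eq_bigr => i _; rewrite scaler_sumr -big_split /=.
by apply: eq_bigr => j _; rewrite !mxE scalerDl scalerA.
Qed.

HB.instance Definition _ (W : vectType F) (b : V1 -> V2 -> W) :=
  GRing.isSemilinear.Build F _ _ _ (tens_lift_fun b)
    (GRing.semilinear_linear (tens_lift_linear b)).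

Definition tens_lift (W : vectType F) (b : V1 -> V2 -> W)
  : 'Hom(tensor_space, W) := linfun (tens_lift_fun b).

Definition tensv (A : {vspace V1}) (B : {vspace V2}) : {vspace tensor_space} :=
  <<[seq tens x y | x <- vbasis A, y <- vbasis B]>>%VS.


Lemma tensDl x x' y : tens (x + x') y = tens x y + tens x' y.
Proof. by rewrite /tens !linearD mulmxDl. Qed.

Lemma tensDr x y y' : tens x (y + y') = tens x y + tens x y'.
Proof. by rewrite /tens linearD mulmxDr. Qed.

Lemma tensZl a x y : tens (a *: x) y = a *: tens x y.
Proof. by rewrite /tens !linearZ -scalemxAl. Qed.

Lemma tensZr a x y : tens x (a *: y) = a *: tens x y.
Proof. by rewrite /tens linearZ -scalemxAr. Qed.

Lemma tens_suml I r (P : pred I) (f : I -> V1) y :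
  tens (\sum_(i <- r | P i) f i) y = \sum_(i <- r | P i) tens (f i) y.
Proof.
apply: (big_morph (tens^~ y)) => [x x'|]; first exact: tensDl.
by rewrite -[0](scale0r 0) tensZl scale0r.
Qed.

Lemma tens_sumr I r (P : pred I) x (f : I -> V2) :
  tens x (\sum_(i <- r | P i) f i) = \sum_(i <- r | P i) tens x (f i).
Proof.
apply: (big_morph (tens x)) => [y y'|]; first exact: tensDr.
by rewrite -[0](scale0r 0) tensZr scale0r.
Qed.

Lemma tens_basis (i : 'I_(\dim {:V1})) (j : 'I_(\dim {:V2})) :
  tens (vbasis {:V1})`_i (vbasis {:V2})`_j = delta_mx i j.
Proof.
by rewrite /tens !rVofE ?vbasisP // trmx_delta mul_delta_mx.
Qed.

Lemma tens_decomp (M : tensor_space) :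
  M = \sum_i \sum_j M i j *: tens (vbasis {:V1})`_i (vbasis {:V2})`_j.
Proof.
rewrite {1}[M]matrix_sum_delta; apply: eq_bigr => i _; apply: eq_bigr => j _.
by rewrite tens_basis.
Qed.

(* Universal property of (tensor_space, tens). *)
Lemma tens_liftE (W : vectType F) (b : V1 -> V2 -> W) :
    (forall y, linear (b^~ y)) -> (forall x, linear (b x)) ->
  forall x y, tens_lift b (tens x y) = b x y.
Proof.
move=> bl br x y.
pose blL y := GRing.isSemilinear.Build F _ _ _ (b^~ y)
  (GRing.semilinear_linear (bl y)).
pose brL x := GRing.isSemilinear.Build F _ _ _ (b x)
  (GRing.semilinear_linear (br x)).
pose fl y : {linear V1 -> W} := HB.pack (b^~ y) (blL y).
pose fr x : {linear V2 -> W} := HB.pack (b x) (brL x).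
rewrite lfunE /= /tens_lift_fun.
have -> : b x y = fl y x by [].
rewrite {2}(coord_basis (vbasisP {:V1}) (memvf x)) linear_sum.
apply: eq_bigr => i _; rewrite linearZ /=.
have -> : b (vbasis {:V1})`_i y = fr (vbasis {:V1})`_i y by [].
rewrite {2}(coord_basis (vbasisP {:V2}) (memvf y)) linear_sum scaler_sumr.
apply: eq_bigr => j _; rewrite linearZ /= scalerA; congr (_ *: _).
by rewrite /tens mxE big_ord1 !mxE.
Qed.

Lemma tens_lift_uniq (W : vectType F) (f g : 'Hom(tensor_space, W)) :
  (forall x y, f (tens x y) = g (tens x y)) -> f = g.
Proof.
move=> fg; apply/lfunP => M; rewrite (tens_decomp M) !linear_sum.
apply: eq_bigr => i _; rewrite !linear_sum; apply: eq_bigr => j _.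
by rewrite !linearZ /= fg.
Qed.

Lemma mem_tensv (A : {vspace V1}) (B : {vspace V2}) x y :
  x \in A -> y \in B -> tens x y \in tensv A B.
Proof.
move=> xA yB; rewrite (coord_vbasis xA) (coord_vbasis yB) tens_suml.
apply: memv_suml => i _; rewrite tensZl tens_sumr; apply: memvZ.
apply: memv_suml => j _; rewrite tensZr; apply/memvZ/memv_span.
by apply: allpairs_f; rewrite mem_nth // size_tuple.
Qed.

Lemma dim_tensv (A : {vspace V1}) (B : {vspace V2}) :
  (\dim (tensv A B) <= \dim A * \dim B)%N.
Proof.
by apply: leq_trans (dim_span _) _; rewrite size_allpairs !size_tuple.
Qed.

End TensorSpace.

Definition tensor_part (F : fieldType) (V1 V2 : superspace F) (p : bool)
  : {vspace tensor_space V1 V2} :=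
  (\sum_(q : bool) tensv (part V1 q) (part V2 (p (+) q)))%VS.

Lemma tensor_part_full (F : fieldType) (V1 V2 : superspace F) :
  (tensor_part V1 V2 false + tensor_part V1 V2 true = fullv)%VS.
Proof.
apply/eqP; rewrite eqEsubv subvf /=; apply/subvP => M _.
rewrite (tens_decomp M); apply: memv_suml => i _; apply: memv_suml => j _.
apply: memvZ.
have /memv_addP[x0 x0P [x1 x1P ->]] :
  (vbasis {:V1})`_i \in (part V1 false + part V1 true)%VS.
  by rewrite part_full memvf.
have /memv_addP[y0 y0P [y1 y1P ->]] :
  (vbasis {:V2})`_j \in (part V2 false + part V2 true)%VS.
  by rewrite part_full memvf.
rewrite tensDl !tensDr [tens x1 y0 + _]addrC addrACA.
rewrite [tens x0 y0 + _]addrC [tens x0 y1 + _]addrC /tensor_part !big_bool /=.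
by apply: memv_add; apply: memv_add; apply: mem_tensv.
Qed.

Lemma tensor_part_direct (F : fieldType) (V1 V2 : superspace F) :
  (tensor_part V1 V2 false :&: tensor_part V1 V2 true = 0)%VS.
Proof.
have dimD (V : superspace F) :
    (\dim (part V false) + \dim (part V true) = \dim {:V})%N.
  by rewrite -part_full dimv_disjoint_sum // part_direct.
have leD p : (\dim (tensor_part V1 V2 p) <=
    \dim (part V1 true) * \dim (part V2 (~~ p))
    + \dim (part V1 false) * \dim (part V2 p))%N.
  rewrite /tensor_part big_bool /= addbT addbF.
  apply: leq_trans (leq_add (dim_tensv _ _) (dim_tensv _ _)).
  by rewrite -dimv_sum_cap leq_addr.
have := dimv_sum_cap (tensor_part V1 V2 false) (tensor_part V1 V2 true).
rewrite tensor_part_full dimvf dim_matrix => eqD.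
apply/eqP; rewrite -dimv_eq0 -leqn0.
rewrite -(leq_add2l (\dim {:V1} * \dim {:V2})) eqD addn0.
apply: leq_trans (leq_add (leD false) (leD true)) _.
rewrite -!dimD /= !mulnDl !mulnDr; apply: eq_leq.
by rewrite addnC addnACA addnC; congr (_ + _)%N; rewrite addnC.
Qed.

Definition tensor (F : fieldType) (V1 V2 : superspace F) : superspace F :=
  Superspace (@tensor_part_full F V1 V2) (@tensor_part_direct F V1 V2).

(* Sign rule: (f (x) g) (x (x) y) = (-1) ^ (|g| |x|) f x (x) g y for
   homogeneous g and x. *)
Definition tensor_op (F : fieldType) (V1 V2 : superspace F)
    (f : 'End(V1)) (g : 'End(V2)) : 'End(tensor V1 V2) :=
  tens_lift (fun x y => \sum_(p : bool) \sum_(q : bool)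
    (-1) ^+ (p && q) *: tens (f (proj V1 q x)) (hcomp p g y)).

Lemma tensor_opE (F : fieldType) (V1 V2 : superspace F)
    (f : 'End(V1)) (g : 'End(V2)) (x : V1) (y : V2) :
  tensor_op f g (tens x y) = \sum_(p : bool) \sum_(q : bool)
    (-1) ^+ (p && q) *: tens (f (proj V1 q x)) (hcomp p g y).
Proof.
rewrite /tensor_op tens_liftE // => z a u v; rewrite scaler_sumr -big_split;
  apply: eq_bigr => p _; rewrite scaler_sumr -big_split; apply: eq_bigr => q _;
  rewrite !linearD !linearZ /=.
- by rewrite tensDl tensZl scalerDr !scalerA mulrC.
- by rewrite tensDr tensZr scalerDr !scalerA mulrC.
Qed.

Lemma hcomp_linear (F : fieldType) (V : superspace F) (p : bool) :
  linear (@hcomp F V p).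
Proof.
move=> a f g; rewrite /hcomp scaler_sumr -big_split; apply: eq_bigr => q _.
by rewrite comp_lfunDr comp_lfunDl -comp_lfunZr -comp_lfunZl.
Qed.

Lemma tensor_op_linearl (F : fieldType) (V1 V2 : superspace F)
  (g : 'End(V2)) : linear (fun f : 'End(V1) => tensor_op f g).
Proof.
move=> a f f'; apply: tens_lift_uniq => x y.
rewrite add_lfunE scale_lfunE !tensor_opE.
rewrite scaler_sumr -big_split; apply: eq_bigr => p _.
rewrite scaler_sumr -big_split; apply: eq_bigr => q _.
by rewrite add_lfunE scale_lfunE tensDl tensZl scalerDr !scalerA mulrC.
Qed.

Lemma tensor_op_linearr (F : fieldType) (V1 V2 : superspace F)
  (f : 'End(V1)) : linear (fun g : 'End(V2) => tensor_op f g).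
Proof.
move=> a g g'; apply: tens_lift_uniq => x y.
rewrite add_lfunE scale_lfunE !tensor_opE.
rewrite scaler_sumr -big_split; apply: eq_bigr => p _.
rewrite scaler_sumr -big_split; apply: eq_bigr => q _.
rewrite hcomp_linear add_lfunE scale_lfunE.
by rewrite tensDr tensZr scalerDr !scalerA mulrC.
Qed.

HB.instance Definition _ (F : fieldType) (V1 V2 : superspace F)
    (f : 'End(V1)) :=
  GRing.isSemilinear.Build F _ _ _ (@tensor_op F V1 V2 f)
    (GRing.semilinear_linear (@tensor_op_linearr F V1 V2 f)).

Definition tensor_opr (F : fieldType) (V1 V2 : superspace F)
    (g : 'End(V2)) (f : 'End(V1)) : 'End(tensor V1 V2) := tensor_op f g.

HB.instance Definition _ (F : fieldType) (V1 V2 : superspace F)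
    (g : 'End(V2)) :=
  GRing.isSemilinear.Build F _ _ _ (@tensor_opr F V1 V2 g)
    (GRing.semilinear_linear (@tensor_op_linearl F V1 V2 g)).

(* The image of L1 (+) L2 in gl(V1 (x) V2). *)
Definition odot (F : fieldType) (V1 V2 : superspace F)
    (L1 : {vspace 'End(V1)}) (L2 : {vspace 'End(V2)})
  : {vspace 'End(tensor V1 V2)} :=
  (linfun (tensor_opr \1%VF) @: L1 + linfun (tensor_op \1%VF) @: L2)%VS.

Lemma mem_odotP (F : fieldType) (V1 V2 : superspace F)
    (L1 : {vspace 'End(V1)}) (L2 : {vspace 'End(V2)}) h :
  reflect (exists f g, [/\ f \in L1, g \in L2 &
                           h = tensor_op f \1%VF + tensor_op \1%VF g])
          (h \in odot L1 L2).
Proof.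
apply: (iffP memv_addP) => [[_ /memv_imgP[f fL ->]] | [f [g [fL gL ->]]]].
  by case=> _ /memv_imgP[g gL ->] ->; exists f, g; rewrite !lfunE.
exists (linfun (tensor_opr \1%VF) f); first exact: memv_img.
exists (linfun (tensor_op \1%VF) g); first exact: memv_img.
by rewrite !lfunE.
Qed.

(* Main.v *)
From HB Require Import structures.
Require Import Defs.
From mathcomp Require Import all_boot all_order all_algebra.
From mathcomp Require Import reals complex.

Set Implicit Arguments.
Unset Strict Implicit.
Unset Printing Implicit Defensive.

Import GRing.Theory Num.Theory.
Import passmx.
Local Open Scope ring_scope.

(** The theorem comes down to one dichotomy ([subalgebra_dichotomy]): a
    subsuperalgebra [K] of [gl V] that contains [sl V1 (+) sl V2] either lies
    in [gl V1 (.) gl V2] or contains [sl V]. The operators [f (x) g] span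
    [gl V], the bracket of [f (x) 1] with [x (x) y] is [[f, x] (x) y], and
    [str (f (x) g) = str f * str g]; with [sl V] of codimension one in [gl V],
    the maximality statements follow by comparing supertraces, since
    [str 1 = m - n].

    The hypothesis on the dimensions means exactly that each [Vi] has two
    distinct basis vectors of the same parity. So there are even square-zero
    elementary operators [X = E_ij] of [V1] and [Y = E_kl] of [V2]; put
    [Z = X (x) Y]. A single such operator generates: a subspace that contains
    it and is stable under the adjoint action of the off-diagonal elementary
    operators contains the whole of [sl] ([sl_generated]).

    Suppose that [str (w Z) = 0] for all [w] in [K]. The supertrace form is
    invariant, so the orthogonal complement of [K] is stable under the adjoint
    action of [K], and it contains [Z], hence [sl V1 (x) sl V2]. The complement
    of the latter is [gl V1 (.) gl V2] ([odot_of_sl_orthogonal]), because the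
    complement of [sl] in one factor consists of the scalars. Hence [K] is
    contained in [gl V1 (.) gl V2].

    Otherwise [str (w Z) <> 0] for some [w] in [K]. As [X] and [Y] are even and
    of square zero, applying [ad (X (x) 1)] and [ad (1 (x) Y)] twice each to
    [w] gives [4 Z w Z]. This is a multiple of [Z] because [Z] has rank one,
    and it is not zero because [str (w Z)] is not. So [Z], and with it [sl V1 (x) sl V2], lies in [K]. To go beyond
    [sl V1 (x) sl V2], one bracket suffices on each side:
    [[Z, (E_ii - E_jj) (x) E_lk] = - X (x) (E_kk + E_ll)], where
    [E_kk + E_ll] has supertrace [+2] or [-2] and so spans [gl V2] modulo
    [sl V2]. Thus [K] contains [sl V1 (x) gl V2], by symmetry
    [gl V1 (x) sl V2], and the sum of these two is [sl V]. *)

(** * Linear predicates *)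

(** A submodule is handled as a predicate closed under linear combinations:
    the submodules below are cut out by conditions such as membership of
    [tensor_op f g] in [K] or orthogonality to all of [K], and a predicate
    states these directly. *)
Section LinearPredicate.
Variables (F : fieldType) (U : lmodType F) (P : U -> Prop).
Hypothesis P0 : P 0.
Hypothesis Plin : forall a u v, P u -> P v -> P (a *: u + v).

Lemma pred_sum I (r : seq I) (Q : pred I) (u : I -> U) :
  (forall x, Q x -> P (u x)) -> P (\sum_(x <- r | Q x) u x).
Proof.
by move=> Pu; apply: big_ind => // x y Px Py; rewrite -[x]scale1r; apply: Plin.
Qed.

Lemma predZ a u : P u -> P (a *: u).
Proof. by move=> Pu; rewrite -[_ *: u]addr0; apply: Plin. Qed.

End LinearPredicate.

(** * Parity of operators *)

Section Grading.
Variables (F : fieldType) (V : superspace F).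
Implicit Types (p q r : bool) (v : V) (f g h : 'End(V)).

Lemma part_cap p : (part V p :&: part V (~~ p) = 0)%VS.
Proof. by case: p; rewrite /= ?part_direct // capvC part_direct. Qed.

Lemma proj_mem p v : proj V p v \in part V p.
Proof. exact: memv_pi. Qed.

Lemma proj_id p v : v \in part V p -> proj V p v = v.
Proof. by move=> vp; apply: daddv_pi_id => //; apply: part_cap. Qed.

Lemma proj_sum v : \sum_(p : bool) proj V p v = v.
Proof.
rewrite big_bool /= /proj daddv_pi_add ?(part_cap true) //.
by rewrite addvC part_full memvf.
Qed.

Lemma proj_part p q v : v \in part V q -> proj V p v = if p == q then v else 0.
Proof.
move=> vq; have [->|npq] := eqVneq p q; first exact: proj_id.
have := proj_sum v; rewrite big_bool => /=.
case: p q vq npq => [] [] // vq _; rewrite (proj_id vq).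
  by move/(congr1 (fun u => u - v)); rewrite addrK subrr.
by move/(congr1 (fun u => - v + u)); rewrite addKr addNr.
Qed.

Lemma proj_proj p q v :
  proj V p (proj V q v) = if p == q then proj V q v else 0.
Proof. exact/proj_part/proj_mem. Qed.

Definition homog p f : Prop :=
  forall q v, v \in part V q -> f v \in part V (p (+) q).

Lemma hcompE p f v :
  hcomp p f v = \sum_(q : bool) proj V (p (+) q) (f (proj V q v)).
Proof.
by rewrite /hcomp sum_lfunE; apply: eq_bigr => q _; rewrite !comp_lfunE.
Qed.

Lemma hcomp_part p f q v :
  v \in part V q -> hcomp p f v = proj V (p (+) q) (f v).
Proof.
move=> vq; rewrite hcompE big_bool !(proj_part _ vq).
by case: q vq => vq /=; rewrite !linear0 ?addr0 ?add0r.
Qed.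

Lemma hom_ext (W : vectType F) (f g : 'Hom(V, W)) :
  (forall p v, v \in part V p -> f v = g v) -> f = g.
Proof.
move=> fg; apply/lfunP => v; rewrite -(proj_sum v) !linear_sum.
by apply: eq_bigr => p _; apply/fg/proj_mem.
Qed.

Lemma homog_hcomp p f : homog p (hcomp p f).
Proof. by move=> q v vq; rewrite (hcomp_part _ _ vq) proj_mem. Qed.

Lemma hcomp_homog p q f : homog p f -> hcomp q f = if q == p then f else 0.
Proof.
move=> fp; apply: hom_ext => r v vr; rewrite (hcomp_part _ _ vr).
rewrite (proj_part _ (fp _ _ vr)) (inj_eq (@addIb r)).
by case: eqP => // _; rewrite lfunE.
Qed.

Lemma hcomp_sum f : \sum_(p : bool) hcomp p f = f.
Proof.
apply: hom_ext => r v vr; rewrite sum_lfunE big_bool /= !(hcomp_part _ _ vr).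
by have := proj_sum (f v); rewrite big_bool /=; case: r {vr} => //=;
  rewrite addrC.
Qed.

(** The bracket, the grading and the signs are only explicit on homogeneous
    operators; multilinear identities are reduced to that case through this
    principle. *)
Lemma homog_ind (P : 'End(V) -> Prop) :
    (forall f g, P f -> P g -> P (f + g)) -> (forall p f, homog p f -> P f) ->
  forall f, P f.
Proof.
move=> PD Ph f; rewrite -(hcomp_sum f) big_bool.
by apply: PD; apply/Ph/homog_hcomp.
Qed.

Lemma comp_lfun_sumr I (r : seq I) (P : pred I) f (E : I -> 'End(V)) :
  (f \o \sum_(i <- r | P i) E i)%VF = \sum_(i <- r | P i) (f \o E i)%VF.
Proof. by apply: big_morph => [g h|]; rewrite ?comp_lfunDr ?comp_lfun0r. Qed.

Lemma comp_lfun_suml I (r : seq I) (P : pred I) (E : I -> 'End(V)) g :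
  (\sum_(i <- r | P i) E i \o g)%VF = \sum_(i <- r | P i) (E i \o g)%VF.
Proof.
by apply: (big_morph (fun f => f \o g)%VF) => [f h|];
  rewrite ?comp_lfunDl ?comp_lfun0l.
Qed.

Lemma homog_comp p q f g :
  homog p f -> homog q g -> homog (p (+) q) (f \o g)%VF.
Proof. by move=> fp gq r v vr; rewrite comp_lfunE -addbA; apply/fp/gq. Qed.

Lemma homog1 : homog false \1%VF.
Proof. by move=> q v vq; rewrite id_lfunE. Qed.

Lemma homogD p f g : homog p f -> homog p g -> homog p (f + g).
Proof. by move=> fp gp q v vq; rewrite add_lfunE memvD ?fp ?gp. Qed.

Lemma homogZ p a f : homog p f -> homog p (a *: f).
Proof. by move=> fp q v vq; rewrite scale_lfunE memvZ ?fp. Qed.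

Lemma homogB p f g : homog p f -> homog p g -> homog p (f - g).
Proof. by move=> fp gp; rewrite -scaleN1r; apply/homogD/homogZ. Qed.

Lemma hcompD p f g : hcomp p (f + g) = hcomp p f + hcomp p g.
Proof. by rewrite -[f]scale1r hcomp_linear !scale1r. Qed.

Lemma sbracketDl f f' g : sbracket (f + f') g = sbracket f g + sbracket f' g.
Proof.
rewrite /sbracket -big_split; apply: eq_bigr => p _; rewrite -big_split.
apply: eq_bigr => q _.
by rewrite hcompD comp_lfunDl comp_lfunDr scalerDr opprD addrACA.
Qed.

Lemma sbracketDr f g g' : sbracket f (g + g') = sbracket f g + sbracket f g'.
Proof.
rewrite /sbracket -big_split; apply: eq_bigr => p _; rewrite -big_split.
apply: eq_bigr => q _.
by rewrite hcompD comp_lfunDl comp_lfunDr scalerDr opprD addrACA.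
Qed.

Lemma sbracket_homog p q f g : homog p f -> homog q g ->
  sbracket f g = (f \o g)%VF - (-1) ^+ (p && q) *: (g \o f)%VF.
Proof.
move=> fp gq; rewrite /sbracket !big_bool /=.
rewrite !(hcomp_homog _ fp) !(hcomp_homog _ gq).
case: p {fp} => /=; case: q {gq} => /=;
  by rewrite ?comp_lfun0l ?comp_lfun0r ?scaler0 ?subr0 ?addr0 ?add0r.
Qed.

Lemma sbracket_even f g :
  homog false f -> sbracket f g = (f \o g)%VF - (g \o f)%VF.
Proof.
move=> f0; elim/homog_ind: g => [g g' IH IH'|p g gp].
  by rewrite sbracketDr IH IH' comp_lfunDl comp_lfunDr opprD addrACA.
by rewrite (sbracket_homog f0 gp) scale1r.
Qed.

(** For an even square-zero [f], the square of [ad f] is a two-sided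
    compression: this is how one matrix entry of [g] is isolated without
    leaving a Lie subalgebra. *)
Lemma ad2_nilpotent f g : homog false f -> (f \o f)%VF = 0 ->
  sbracket f (sbracket f g) = - (f \o g \o f)%VF *+ 2.
Proof.
move=> f0 ff; rewrite (sbracket_even g f0) sbracket_even //.
rewrite comp_lfunDr comp_lfunDl comp_lfunNl comp_lfunNr.
rewrite !comp_lfunA ff comp_lfun0l.
by rewrite -!comp_lfunA ff comp_lfun0r sub0r subr0 mulr2n.
Qed.

End Grading.

(** * The supertrace *)

Section Trace.
Variables (F : fieldType) (V : superspace F).
Implicit Types (p q r : bool) (v : V) (f g h : 'End(V)).

Lemma lftraceC (W : vectType F) (f g : 'End(W)) :
  lftrace (f \o g)%VF = lftrace (g \o f)%VF.
Proof. by rewrite /lftrace !(mxof_comp _ _ (vbasisP {:W})) mxtrace_mulC. Qed.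

(** Supertraces are only ever evaluated on operators of rank one, so this
    formula replaces changes of basis. *)
Lemma lftrace_rank1 (W : vectType F) (phi : 'Hom(W, F^o)) (u : W)
    (f : 'End(W)) :
  (forall w, f w = phi w *: u) -> lftrace f = phi u.
Proof.
move=> fE; rewrite [in RHS](coord_basis (vbasisP {:W}) (memvf u)) linear_sum.
apply: eq_bigr => i _.
by rewrite mxE /= vecof_delta fE linearZ !mxE linearZ /= mulrC.
Qed.

Lemma proj_homog_comp p f g : homog p f ->
  forall q, (proj V q \o f)%VF = (f \o proj V (p (+) q))%VF.
Proof.
move=> fp q; apply: hom_ext => r v vr; rewrite !comp_lfunE.
rewrite (proj_part _ (fp _ _ vr)) (proj_part _ vr).
rewrite -(inj_eq (@addbI p)) addKb; case: ifP => //.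
by rewrite linear0.
Qed.

Lemma straceE f : strace f
  = lftrace (proj V false \o f) - lftrace (proj V true \o f).
Proof.
have pp q : (proj V q \o proj V q)%VF = proj V q.
  by apply/lfunP => v; rewrite comp_lfunE proj_proj eqxx.
by rewrite /strace ![lftrace (_ \o proj _ _)]lftraceC !comp_lfunA !pp.
Qed.

Lemma strace_rank1 (phi : 'Hom(V, F^o)) u f :
    (forall v, f v = phi v *: u) ->
  strace f = phi (proj V false u) - phi (proj V true u).
Proof.
move=> fE; rewrite straceE; congr (_ - _); apply: lftrace_rank1 => v;
  by rewrite comp_lfunE fE linearZ.
Qed.

(** The usual sign is [(-1) ^ (p q)]. When the parities [p] and [q] of [f] and
    [g] differ, both sides vanish, and when they agree it is [(-1) ^ p]; this
    form makes sense for a nonhomogeneous [g]. *)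
Lemma straceC p f g : homog p f ->
  strace (f \o g) = (-1) ^+ p * strace (g \o f).
Proof.
move=> fp; rewrite !straceE !comp_lfunA.
rewrite ![lftrace (_ \o g \o f)]lftraceC !comp_lfunA !(proj_homog_comp g fp).
case: p {fp} => /=; last by rewrite mul1r.
by rewrite mulN1r opprB.
Qed.

Lemma straceD f g : strace (f + g) = strace f + strace g.
Proof. exact: linearD. Qed.

Lemma straceZ a f : strace (a *: f) = a * strace f.
Proof. exact: linearZ. Qed.

Lemma straceB f g : strace (f - g) = strace f - strace g.
Proof. exact: linearB. Qed.

Lemma strace0 : strace (0 : 'End(V)) = 0.
Proof. exact: linear0. Qed.

Lemma strace_sum I (r : seq I) (P : pred I) (E : I -> 'End(V)) :
  strace (\sum_(i <- r | P i) E i)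
  = \sum_(i <- r | P i) (strace (E i) : F) :> F.
Proof. exact: linear_sum. Qed.

Lemma strace_odd f : homog true f -> strace f = 0.
Proof.
move=> f1; rewrite /strace !(proj_homog_comp f f1) /= -!comp_lfunA.
have pp q : (proj V (~~ q) \o proj V q)%VF = 0.
  by apply/lfunP => v; rewrite comp_lfunE proj_proj lfunE; case: q.
by rewrite (pp true) (pp false) !comp_lfun0r subrr.
Qed.

Lemma strace_hcomp p f : strace (hcomp p f) = if p then 0 else strace f.
Proof.
case: p; first exact/strace_odd/homog_hcomp.
rewrite -[in RHS](hcomp_sum f) big_bool straceD.
by rewrite (strace_odd (homog_hcomp _ _)) add0r.
Qed.

Lemma strace_sbracket f g : strace (sbracket f g) = 0.
Proof.
elim/homog_ind: f => [f f' IH IH'|p f fp].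
  by rewrite sbracketDl straceD IH IH' addr0.
elim/homog_ind: g => [g g' IH IH'|q g gq].
  by rewrite sbracketDr straceD IH IH' addr0.
rewrite (sbracket_homog fp gq) straceB straceZ.
have := homog_comp gq fp; have := homog_comp fp gq; rewrite (straceC g fp).
case: p fp => fp; case: q gq => gq /=; rewrite ?subrr //;
  by move=> _ /strace_odd ->; rewrite !mulr0 subrr.
Qed.

(** Invariance is what makes the orthogonal complement of a subalgebra a
    module over it. *)
Lemma strace_invariant f g h :
  strace (sbracket f g \o h) = strace (f \o sbracket g h).
Proof.
elim/homog_ind: f => [f f' IH IH'|p f fp].
  by rewrite sbracketDl !comp_lfunDl !straceD IH IH'.
elim/homog_ind: h => [h h' IH IH'|r h hr].
  by rewrite sbracketDr !comp_lfunDr !straceD IH IH'.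
elim/homog_ind: g => [g g' IH IH'|q g gq].
  by rewrite sbracketDr sbracketDl comp_lfunDl comp_lfunDr !straceD IH IH'.
rewrite (sbracket_homog fp gq) (sbracket_homog gq hr).
rewrite comp_lfunDl comp_lfunDr comp_lfunNl comp_lfunNr !straceB.
rewrite -comp_lfunZl -comp_lfunZr !straceZ !comp_lfunA; congr (_ - _).
rewrite -!comp_lfunA (straceC (f \o h) gq) comp_lfunA.
have := homog_comp (homog_comp fp hr) gq.
case: p fp => fp; case: q gq => gq; case: r hr => hr /= fhg;
  by rewrite ?(strace_odd fhg) ?mulr0 // ?mul1r // mulN1r ?mulN1r ?opprK ?mul1r.
Qed.
End Trace.


(** * Elementary operators *)

Section Elementary.
Variables (F : fieldType) (V : superspace F).

(** Indexing by parity and position makes the parity of a basis vector the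
    tag of its index. *)
Definition hindex : finType := {p : bool & 'I_(\dim (part V p))}.
Implicit Types (i j k l : hindex) (f g : 'End(V)) (v : V).

Definition hvec i : V := (vbasis (part V (tag i)))`_(tagged i).

Definition hcoord_fun i v : F^o :=
  coord (vbasis (part V (tag i))) (tagged i) (proj V (tag i) v).

Lemma hcoord_linear i : linear (hcoord_fun i).
Proof. by move=> a u v; rewrite /hcoord_fun !linearD !linearZ. Qed.

HB.instance Definition _ i := GRing.isSemilinear.Build F _ _ _ (hcoord_fun i)
  (GRing.semilinear_linear (hcoord_linear i)).

Definition hcoord i : 'Hom(V, F^o) := linfun (hcoord_fun i).

Definition elem_fun i j v : V := hcoord j v *: hvec i.

Lemma elem_linear i j : linear (elem_fun i j).
Proof.
by move=> a u v; rewrite /elem_fun linearD linearZ /= scalerDl scalerA.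
Qed.

HB.instance Definition _ i j := GRing.isSemilinear.Build F _ _ _ (elem_fun i j)
  (GRing.semilinear_linear (elem_linear i j)).

Definition elem i j : 'End(V) := linfun (elem_fun i j).

Lemma elemE i j v : elem i j v = hcoord j v *: hvec i.
Proof. by rewrite lfunE. Qed.

Lemma hvec_part i : hvec i \in part V (tag i).
Proof. by apply: vbasis_mem; rewrite mem_nth // size_tuple. Qed.

Lemma hcoord_proj p i v :
  hcoord i (proj V p v) = if p == tag i then hcoord i v else 0.
Proof.
rewrite !lfunE /= /hcoord_fun proj_proj eq_sym; case: eqP => [->//|_].
by rewrite linear0.
Qed.

Lemma hcoord_vec i j : hcoord i (hvec j) = (i == j)%:R.
Proof.
rewrite lfunE /= /hcoord_fun (proj_part _ (hvec_part j)).
have [/eqP|npq] := boolP (tag i == tag j); last first.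
  by rewrite linear0; case: eqP => // ij; rewrite ij eqxx in npq.
case: i j => p i [q j] /= pq; case: q / pq j => j.
by rewrite /hvec /= coord_free ?(basis_free (vbasisP _)) // eq_Tagged /= eq_sym.
Qed.

Lemma hvec_sum v : v = \sum_i hcoord i v *: hvec i.
Proof.
pose mk p (m : 'I_(\dim (part V p))) : hindex := existT _ p m.
rewrite -{1}(proj_sum v).
rewrite (eq_bigr (fun p => \sum_m hcoord (mk p m) v *: hvec (mk p m))).
  by rewrite sig_big_dep; apply: eq_bigr => -[].
move=> p _; rewrite {1}(coord_vbasis (proj_mem p v)).
by apply: eq_bigr => m _; rewrite lfunE.
Qed.

Lemma hvec_ext (W : vectType F) (f g : 'Hom(V, W)) :
  (forall i, f (hvec i) = g (hvec i)) -> f = g.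
Proof.
move=> fg; apply/lfunP => v; rewrite (hvec_sum v) !linear_sum.
by apply: eq_bigr => i _; rewrite !linearZ /= fg.
Qed.

Lemma elem_vec i j k : elem i j (hvec k) = (j == k)%:R *: hvec i.
Proof. by rewrite elemE hcoord_vec. Qed.

Lemma elem_comp i j k l : (elem i j \o elem k l)%VF = (j == k)%:R *: elem i l.
Proof.
apply/lfunP => v; rewrite comp_lfunE scale_lfunE !elemE linearZ /= hcoord_vec.
by rewrite !scalerA mulrC.
Qed.

Lemma homog_elem i j : homog (tag i (+) tag j) (elem i j).
Proof.
move=> q v vq; rewrite elemE -(proj_id vq) hcoord_proj.
case: eqP => [->|_]; last by rewrite scale0r mem0v.
by rewrite addbK memvZ ?hvec_part.
Qed.

Lemma even_elem i j : tag i = tag j -> homog false (elem i j).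
Proof. by move=> ij; have := @homog_elem i j; rewrite ij addbb. Qed.

Lemma elem_sum f : f = \sum_i \sum_j hcoord i (f (hvec j)) *: elem i j.
Proof.
apply: hvec_ext => k; rewrite {1}(hvec_sum (f (hvec k))) sum_lfunE.
apply: eq_bigr => i _; rewrite sum_lfunE (bigD1 k) //= big1 ?addr0.
  by rewrite scale_lfunE elem_vec eqxx scale1r.
by move=> j jk; rewrite scale_lfunE elem_vec (negPf jk) scale0r scaler0.
Qed.

Lemma strace_elem f i j :
  strace (f \o elem i j) = (-1) ^+ tag j * hcoord j (f (hvec i)).
Proof.
rewrite (@strace_rank1 _ _ (hcoord j) (f (hvec i))) => [|v].
  by rewrite !hcoord_proj; case: (tag j); rewrite ?mulN1r ?mul1r ?sub0r ?subr0.
by rewrite comp_lfunE elemE linearZ.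
Qed.

Lemma strace_elem1 i j : strace (elem i j) = (-1) ^+ tag i * (i == j)%:R.
Proof.
rewrite -[elem i j]comp_lfun1l strace_elem id_lfunE hcoord_vec eq_sym.
by case: eqP => [->//|_]; rewrite !mulr0.
Qed.

Lemma elem_sl i j : i != j -> elem i j \in sl V.
Proof. by move=> /negPf ij; rewrite mem_sl strace_elem1 ij mulr0. Qed.

Lemma elem_diff_sl i j : tag i = tag j -> elem i i - elem j j \in sl V.
Proof. by move=> ij; rewrite mem_sl straceB !strace_elem1 !eqxx ij subrr. Qed.

Lemma elem_sdiff_sl i j :
  (-1) ^+ tag i *: elem i i - (-1) ^+ tag j *: elem j j \in sl V.
Proof.
rewrite mem_sl straceB !straceZ !strace_elem1 !eqxx !mulr1.
by rewrite -!expr2 !sqrr_sign subrr.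
Qed.

(** Testing against [E_jk] kills the entry [(k, j)], and testing against
    [(-1)^|i| E_ii - (-1)^|j| E_jj] equates two diagonal entries. The test
    operators are homogeneous, which allows the argument to be placed on
    either side of [f]. *)
Lemma scalar_of_sl_orthogonal i f :
    (forall p g, homog p g -> g \in sl V -> strace (g \o f) = 0) ->
  f = hcoord i (f (hvec i)) *: \1%VF.
Proof.
move=> f0; apply: hvec_ext => j; rewrite scale_lfunE id_lfunE.
have {}f0 p g : homog p g -> g \in sl V -> strace (f \o g) = 0.
  move=> gp /(f0 _ _ gp)/eqP; rewrite (straceC f gp) mulf_eq0 signr_eq0.
  by move/eqP.
rewrite [LHS]hvec_sum (bigD1 j) //= big1 ?addr0 => [|k kj].
  congr (_ *: _); have := f0 false _ _ (elem_sdiff_sl i j).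
  rewrite comp_lfunDr comp_lfunNr -!comp_lfunZr straceB !straceZ !strace_elem.
  rewrite !mulrA -!expr2 !sqrr_sign !mul1r => ij0; apply/esym/eqP.
  by rewrite -subr_eq0 ij0 //; apply: homogB; apply/homogZ/even_elem.
have jk : j != k by rewrite eq_sym.
move/eqP: (f0 _ _ (@homog_elem _ _) (elem_sl jk)).
by rewrite strace_elem mulf_eq0 signr_eq0 /= => /eqP->; rewrite scale0r.
Qed.

Lemma sum_elem : \sum_i elem i i = \1%VF.
Proof.
apply/lfunP => v; rewrite sum_lfunE id_lfunE [RHS]hvec_sum.
by apply: eq_bigr => i _; rewrite elemE.
Qed.

Section ElementaryPredicate.
Variable P : 'End(V) -> Prop.
Hypothesis P0 : P 0.
Hypothesis Plin : forall a f g, P f -> P g -> P (a *: f + g).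

Lemma elem_ind : (forall i j, P (elem i j)) -> forall f, P f.
Proof.
move=> Pe f; rewrite (elem_sum f).
apply: (pred_sum P0 Plin) => i _; apply: (pred_sum P0 Plin) => j _.
exact/(predZ P0 Plin)/Pe.
Qed.

(** Modulo the differences [E_ii - (-1)^(|i|+|i0|) E_i0i0], a diagonal operator
    is a multiple of [E_i0i0] by, up to sign, its supertrace. *)
Lemma sl_ind :
    (forall i j, i != j -> P (elem i j)) ->
    (forall i j, P (elem i i - (-1) ^+ (tag i (+) tag j) *: elem j j)) ->
  forall f, f \in sl V -> P f.
Proof.
move=> Pij Pii f fsl; pose c i : F := hcoord i (f (hvec i)).
have c0 : \sum_(i : hindex) (-1) ^+ tag i * c i = 0.
  transitivity (strace f : F); last by apply/eqP; rewrite -mem_sl.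
  rewrite [f in RHS]elem_sum.
  rewrite strace_sum; apply: eq_bigr => i _.
  rewrite strace_sum (bigD1 i) //= big1 => [|j ji].
    by rewrite addr0 straceZ strace_elem1 eqxx mulr1 mulrC.
  by rewrite straceZ strace_elem1 eq_sym (negPf ji) !mulr0.
rewrite (elem_sum f).
rewrite (eq_bigr (fun i => \sum_(j | j != i) hcoord i (f (hvec j)) *: elem i j
   + c i *: elem i i)) => [|i _]; last by rewrite (bigD1 i) //= addrC.
rewrite big_split /= -[X in P (X + _)]scale1r; apply: Plin.
  apply: (pred_sum P0 Plin) => i _; apply: (pred_sum P0 Plin) => j ji.
  apply/(predZ P0 Plin)/Pij.
  by rewrite eq_sym.
have [i0 _|noidx] := pickP (@predT hindex); last first.
  by apply: (pred_sum P0 Plin) => i _; have := noidx i.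
suff -> : \sum_i c i *: elem i i =
    \sum_i c i *: (elem i i - (-1) ^+ (tag i (+) tag i0) *: elem i0 i0).
  by apply: (pred_sum P0 Plin) => i _; exact: (predZ P0 Plin).
under [RHS]eq_bigr do rewrite scalerBr scalerA.
rewrite sumrB -scaler_suml.
rewrite (eq_bigr (fun i => (-1) ^+ tag i0 * ((-1) ^+ tag i * c i))) => [|i _].
  by rewrite -mulr_sumr c0 mulr0 scale0r subr0.
by rewrite signr_addb mulrA mulrC [X in _ = X * _]mulrC.
Qed.

End ElementaryPredicate.

Lemma sbracket_elem (a b c d : hindex) : sbracket (elem a b) (elem c d) =
  (b == c)%:R *: elem a d
  - (-1) ^+ ((tag a (+) tag b) && (tag c (+) tag d)) *:
      ((d == a)%:R *: elem c b).
Proof.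
by rewrite (sbracket_homog (homog_elem _ _) (homog_elem _ _)) !elem_comp.
Qed.

(** [E_aj = [E_ai, E_ij]] fills column [j], and [E_ab] is up to sign
    [[E_jb, E_aj]]. Row [j] is out of reach here: for [a = j] the first bracket
    is diagonal. *)
Lemma ad_closed_elem (P : 'End(V) -> Prop) (P0 : P 0)
    (Plin : forall (c : F) f g, P f -> P g -> P (c *: f + g))
    (Pad : forall i j f, i != j -> P f -> P (sbracket (elem i j) f)) i j :
  i != j -> P (elem i j) -> forall a b, a != j -> a != b -> P (elem a b).
Proof.
move=> ij Pij.
have col a : a != j -> P (elem a j).
  have [->//|ai aj] := eqVneq a i.
  have := Pad _ _ _ ai Pij.
  rewrite sbracket_elem eqxx scale1r eq_sym (negPf aj).
  by rewrite scale0r scaler0 subr0.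
move=> a b aj ab; have [->|bj] := eqVneq b j; first exact: col.
have jb : j != b by rewrite eq_sym.
have := Pad _ _ _ jb (col a aj).
rewrite sbracket_elem eqxx scale1r eq_sym (negPf ab) scale0r sub0r.
set e := _ ^+ _ => /(predZ P0 Plin (- e)); rewrite /e.
by rewrite scalerN scaleNr opprK scalerA -expr2 sqrr_sign scale1r.
Qed.

(** As [E_ij] is even, [E_ij] and [E_ji] span together with their bracket a
    copy of [sl_2], in which [ad (E_ji) ^ 2] takes [E_ij] to [-2 E_ji]. Once
    [E_ji] is reached, [ad_closed_elem] applied to both gives all rows. *)
Lemma sl_generated (P : 'End(V) -> Prop) (two_neq0 : (2 : F) != 0) (P0 : P 0)
    (Plin : forall (c : F) f g, P f -> P g -> P (c *: f + g))
    (Pad : forall i j f, i != j -> P f -> P (sbracket (elem i j) f)) i j :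
  i != j -> tag i = tag j -> P (elem i j) -> forall f, f \in sl V -> P f.
Proof.
move=> ij tij Pij.
have ji : j != i by rewrite eq_sym.
have Pji : P (elem j i).
  have := Pad _ _ _ ji (Pad _ _ _ ji Pij).
  rewrite sbracket_elem !eqxx tij !addbb !scale1r.
  rewrite (sbracket_even _ (even_elem (esym tij))).
  rewrite comp_lfunDr comp_lfunDl comp_lfunNr comp_lfunNl !elem_comp.
  rewrite !eqxx (negPf ij) !scale1r !scale0r.
  rewrite sub0r subr0 -opprD -mulr2n => /(predZ P0 Plin (- (2^-1))).
  by rewrite scaleNr scalerN opprK -scaler_nat scalerA mulVf // scale1r.
have Pab a b : a != b -> P (elem a b).
  move=> ab; have [aj|aj] := eqVneq a j; last first.
    exact: (ad_closed_elem P0 Plin Pad ij Pij).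
  by apply: (ad_closed_elem P0 Plin Pad ji Pji) => //; rewrite aj.
apply: sl_ind => // a b; have [->|ab] := eqVneq a b.
  by rewrite addbb scale1r subrr.
have ba : b != a by rewrite eq_sym.
have := Pad _ _ _ ab (Pab _ _ ba); rewrite sbracket_elem !eqxx !scale1r.
by rewrite [tag b (+) _]addbC andbb.
Qed.

End Elementary.


(** * Operators on the tensor product *)

Section Tensor.
Variables (F : fieldType) (V1 V2 : superspace F).
Local Notation V := (tensor V1 V2).
Local Notation t := (@tensor_op F V1 V2).

Lemma tens_part p q (x : V1) (y : V2) :
  x \in part V1 p -> y \in part V2 q -> tens x y \in part V (p (+) q).
Proof.
move=> xp yq; apply: (subvP (sumv_sup p _ (subvv _))) => //=.
by apply: mem_tensv; rewrite // addbC addbA addbb.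
Qed.

Lemma tensor_part_ind (U : {vspace V}) (w : 'End(V)) r :
    (forall p (x : V1) (y : V2), x \in part V1 p -> y \in part V2 (r (+) p) ->
       w (tens x y) \in U) ->
  forall v, v \in part V r -> w v \in U.
Proof.
move=> wU v; suff /subvP sUw : (part V r <= w @^-1: U)%VS.
  by move/sUw; rewrite -memv_preim.
apply/subv_sumP => p _; apply/span_subvP => _ /allpairsP[[x y] /= [xp yp ->]].
by rewrite -memv_preim; apply: (wU p); apply: vbasis_mem.
Qed.

Lemma tens_ext (W : vectType F) (f g : 'Hom(V, W)) :
    (forall r (x : V1) (y : V2),
       x \in part V1 r -> f (tens x y) = g (tens x y)) ->
  f = g.
Proof.
move=> fg; apply: tens_lift_uniq => x y; rewrite -(proj_sum x) tens_suml.
by rewrite !linear_sum; apply: eq_bigr => r _; apply/fg/proj_mem.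
Qed.

Lemma tensor_op_tens q f g r (x : V1) (y : V2) : homog q g -> x \in part V1 r ->
  t f g (tens x y) = (-1) ^+ (q && r) *: tens (f x) (g y).
Proof.
move=> gq xr; rewrite tensor_opE !big_bool /=.
rewrite !(proj_part _ xr) !(hcomp_homog _ gq).
have t0l (z : V2) : tens (0 : V1) z = 0.
  by rewrite -(scale0r (0 : V1)) tensZl scale0r.
have t0r (z : V1) : tens z (0 : V2) = 0.
  by rewrite -(scale0r (0 : V2)) tensZr scale0r.
by case: q {gq}; case: r {xr} => /=;
  rewrite ?linear0 ?lfunE /= ?t0l ?t0r ?scaler0 ?addr0 ?add0r.
Qed.

Lemma tensor_opDl f f' g : t (f + f') g = t f g + t f' g.
Proof. exact: (linearD (tensor_opr g)). Qed.

Lemma tensor_opDr f g g' : t f (g + g') = t f g + t f g'.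
Proof. exact: linearD. Qed.

Lemma tensor_opZl a f g : t (a *: f) g = a *: t f g.
Proof. exact: (linearZ_LR (tensor_opr g)). Qed.

Lemma tensor_opZr a f g : t f (a *: g) = a *: t f g.
Proof. exact: linearZ_LR. Qed.

Lemma tensor_opBl f f' g : t (f - f') g = t f g - t f' g.
Proof. exact: (linearB (tensor_opr g)). Qed.

Lemma tensor_opBr f g g' : t f (g - g') = t f g - t f g'.
Proof. exact: linearB. Qed.

Lemma tensor_op0l g : t 0 g = 0.
Proof. exact: (linear0 (tensor_opr g)). Qed.

Lemma tensor_op0r f : t f 0 = 0.
Proof. exact: linear0. Qed.

Lemma tensor_op_suml I r (P : pred I) (E : I -> 'End(V1)) g :
  t (\sum_(i <- r | P i) E i) g = \sum_(i <- r | P i) t (E i) g.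
Proof. exact: (linear_sum (tensor_opr g)). Qed.

Lemma tensor_op_sumr I r (P : pred I) f (E : I -> 'End(V2)) :
  t f (\sum_(i <- r | P i) E i) = \sum_(i <- r | P i) t f (E i).
Proof. exact: linear_sum. Qed.

(** The Koszul sign comes from moving [g] past [f']; the parities of the two
    outer factors [f] and [g'] do not enter. *)
Lemma tensor_op_comp q p f g f' g' : homog q g -> homog p f' ->
  (t f g \o t f' g')%VF = (-1) ^+ (q && p) *: t (f \o f')%VF (g \o g')%VF.
Proof.
move=> gq fp; elim/homog_ind: g' => [g1 g2 IH1 IH2|s g' gs].
  by rewrite tensor_opDr !comp_lfunDr IH1 IH2 tensor_opDr scalerDr.
apply: tens_ext => r x y xr; rewrite comp_lfunE scale_lfunE.
rewrite (tensor_op_tens _ _ gs xr) linearZ /=.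
rewrite (tensor_op_tens _ _ gq (fp _ _ xr)).
rewrite (tensor_op_tens _ _ (homog_comp gq gs) xr) !comp_lfunE !scalerA.
rewrite -!signr_addb; congr (_ ^+ _ *: _).
by case: q {gq}; case: p {fp}; case: s {gs}; case: r {xr}.
Qed.

(** When [f'] is even there is no sign, and [g] may be any operator. *)
Lemma tensor_op_comp_even f g f' g' : homog false f' ->
  (t f g \o t f' g')%VF = t (f \o f')%VF (g \o g')%VF.
Proof.
move=> f'0; elim/homog_ind: g => [g1 g2 IH1 IH2|q g gq].
  by rewrite tensor_opDr !comp_lfunDl IH1 IH2 tensor_opDr.
by rewrite (tensor_op_comp _ _ gq f'0) andbF scale1r.
Qed.

Lemma tensor_op1 : t \1%VF \1%VF = \1%VF.
Proof.
apply: tens_ext => r x y xr.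
by rewrite (tensor_op_tens _ _ (@homog1 _ _) xr) scale1r !id_lfunE.
Qed.

Lemma homog_tensor_op p q f g :
  homog p f -> homog q g -> homog (p (+) q) (t f g).
Proof.
move=> fp gq r v; apply: tensor_part_ind => s x y xs yrs.
rewrite (tensor_op_tens _ _ gq xs) memvZ //.
have := tens_part (fp _ _ xs) (gq _ _ yrs).
by congr (_ \in part V _); case: p q r s {fp gq v xs yrs} => [] [] [] [].
Qed.

Lemma hcomp_tensor_opl p f : hcomp p (t f \1%VF) = t (hcomp p f) \1%VF.
Proof.
elim/homog_ind: f => [f f' IH IH'|q f fq].
  by rewrite tensor_opDl !hcompD IH IH' tensor_opDl.
have := homog_tensor_op fq (@homog1 _ V2); rewrite addbF => tq.
rewrite (hcomp_homog _ tq) (hcomp_homog _ fq).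
by case: eqP => // _; rewrite tensor_op0l.
Qed.

Lemma hcomp_tensor_opr p g : hcomp p (t \1%VF g) = t \1%VF (hcomp p g).
Proof.
elim/homog_ind: g => [g g' IH IH'|q g gq].
  by rewrite tensor_opDr !hcompD IH IH' tensor_opDr.
have := homog_tensor_op (@homog1 _ V1) gq; rewrite addFb => tq.
rewrite (hcomp_homog _ tq) (hcomp_homog _ gq).
by case: eqP => // _; rewrite tensor_op0r.
Qed.

Lemma sbracket_tensorl f x y :
  sbracket (t f \1%VF) (t x y) = t (sbracket f x) y.
Proof.
elim/homog_ind: f => [f f' IH IH'|p f fp].
  by rewrite tensor_opDl !sbracketDl tensor_opDl IH IH'.
elim/homog_ind: x => [x x' IH IH'|q x xq].
  by rewrite tensor_opDl !sbracketDr tensor_opDl IH IH'.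
elim/homog_ind: y => [y y' IH IH'|r y yr].
  by rewrite tensor_opDr !sbracketDr IH IH' tensor_opDr.
rewrite (sbracket_homog fp xq) tensor_opBl tensor_opZl.
rewrite (sbracket_homog (homog_tensor_op fp (@homog1 _ V2))
  (homog_tensor_op xq yr)).
rewrite (tensor_op_comp _ _ (@homog1 _ V2) xq) (tensor_op_comp _ _ yr fp).
rewrite comp_lfun1l comp_lfun1r scale1r scalerA -signr_addb.
by congr (_ - _ ^+ _ *: _); case: p {fp}; case: q {xq}; case: r {yr}.
Qed.

(** The sign is from moving [g] past [x]. It is harmless below, where only
    membership in subspaces matters. *)
Lemma sbracket_tensorr p q g x y : homog p g -> homog q x ->
  sbracket (t \1%VF g) (t x y) = (-1) ^+ (p && q) *: t x (sbracket g y).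
Proof.
move=> gp xq; elim/homog_ind: y => [y y' IH IH'|r y yr].
  by rewrite tensor_opDr !sbracketDr IH IH' tensor_opDr scalerDr.
rewrite (sbracket_homog gp yr) tensor_opBr tensor_opZr.
rewrite (sbracket_homog (homog_tensor_op (@homog1 _ V1) gp)
  (homog_tensor_op xq yr)).
rewrite (tensor_op_comp _ _ gp xq) (tensor_op_comp _ _ yr (@homog1 _ V1)).
rewrite comp_lfun1l comp_lfun1r andbF scale1r scalerBr scalerA -signr_addb.
by congr (_ - _ ^+ _ *: _); case: p {gp}; case: q {xq}; case: r {yr}.
Qed.

Lemma sbracket1r (W : superspace F) (f : 'End(W)) : sbracket f \1%VF = 0.
Proof.
elim/homog_ind: f => [f f' IH IH'|p f fp].
  by rewrite sbracketDl IH IH' addr0.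
rewrite (sbracket_homog fp (@homog1 _ _)) andbF.
by rewrite comp_lfun1l comp_lfun1r scale1r subrr.
Qed.

Lemma sbracket_tensor_r1 g g' :
  sbracket (t \1%VF g) (t \1%VF g') = t \1%VF (sbracket g g').
Proof.
elim/homog_ind: g => [g g1 IH IH'|p g gp].
  by rewrite tensor_opDr !sbracketDl tensor_opDr IH IH'.
by rewrite (sbracket_tensorr _ gp (@homog1 _ _)) andbF scale1r.
Qed.

Lemma sbracket_tensor_rl g f : sbracket (t \1%VF g) (t f \1%VF) = 0.
Proof.
elim/homog_ind: g => [g g1 IH IH'|p g gp].
  by rewrite tensor_opDr !sbracketDl IH IH' addr0.
elim/homog_ind: f => [f f' IH IH'|q f fq].
  by rewrite tensor_opDl !sbracketDr IH IH' addr0.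
by rewrite (sbracket_tensorr _ gp fq) sbracket1r tensor_op0r scaler0.
Qed.

Lemma odot_subsuperalgebra (L1 : {vspace 'End(V1)}) (L2 : {vspace 'End(V2)}) :
    lie_subsuperalgebra L1 -> lie_subsuperalgebra L2 ->
  lie_subsuperalgebra (odot L1 L2).
Proof.
move=> [h1 b1] [h2 b2]; split=> [p _ /mem_odotP[f [g [fL gL ->]]]|].
  apply/mem_odotP; exists (hcomp p f), (hcomp p g); rewrite h1 ?h2 //.
  by rewrite hcompD hcomp_tensor_opl hcomp_tensor_opr.
move=> _ _ /mem_odotP[f [g [fL gL ->]]] /mem_odotP[f' [g' [fL' gL' ->]]].
apply/mem_odotP; exists (sbracket f f'), (sbracket g g'); rewrite b1 ?b2 //.
rewrite sbracketDl !sbracketDr sbracket_tensor_r1 sbracket_tensor_rl.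
by rewrite !sbracket_tensorl sbracket1r tensor_op0l addr0 add0r.
Qed.

End Tensor.


(** * Spanning and orthogonality in the tensor product *)

Section TensorElementary.
Variables (F : fieldType) (V1 V2 : superspace F).
Local Notation V := (tensor V1 V2).
Local Notation t := (@tensor_op F V1 V2).
Implicit Types (i j a b : hindex V1) (k l : hindex V2).

Lemma tens_linear_ind (P : V -> Prop) :
    P 0 -> (forall (e : F) u v, P u -> P v -> P (e *: u + v)) ->
    (forall i k, P (tens (hvec i) (hvec k))) ->
  forall v, P v.
Proof.
move=> P0 Plin Ph v.
have PS := pred_sum P0 Plin; have PZ := predZ P0 Plin.
rewrite (tens_decomp v); apply: (PS) => r _; apply: (PS) => s _; apply: (PZ).
rewrite (hvec_sum (vbasis _)`_r) tens_suml; apply: (PS) => i _; rewrite tensZl.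
rewrite (hvec_sum (vbasis _)`_s) tens_sumr; apply/PZ/PS => k _; rewrite tensZr.
exact: PZ.
Qed.

Definition tcoord_fun j l (x : V1) (y : V2) : F^o := hcoord j x * hcoord l y.

Definition tcoord j l : 'Hom(V, F^o) := tens_lift (tcoord_fun j l).

Lemma tcoord_tens j l (x : V1) (y : V2) :
  tcoord j l (tens x y) = hcoord j x * hcoord l y.
Proof.
rewrite /tcoord tens_liftE // => [z e u w|z e u w];
  rewrite /tcoord_fun linearD linearZ.
  by rewrite mulrDl -mulrA.
by rewrite mulrDr mulrCA.
Qed.

(** The sign makes [E_ij (x) E_kl] differ from the elementary operator of the
    product basis by at most a factor [-1]; in particular it has rank one. *)
Lemma tensor_elemE i j k l (v : V) : t (elem i j) (elem k l) v =
  (-1) ^+ ((tag k (+) tag l) && tag j) *: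
    (tcoord j l v *: tens (hvec i) (hvec k)).
Proof.
move: v; apply: tens_linear_ind => [|e u v IHu IHv|a b].
- by rewrite !linear0 scale0r scaler0.
- rewrite !linearD !linearZ /= IHu IHv scalerDl !scalerA.
  by congr (_ *: _ + _ *: _); rewrite [RHS]mulrC // mulrAC mulrC.
rewrite (tensor_op_tens _ _ (homog_elem k l) (hvec_part a)).
rewrite tcoord_tens !elem_vec !hcoord_vec tensZl tensZr scalerA.
by have [->//|_] := eqVneq j a; rewrite !(mul0r, scale0r) !scaler0.
Qed.

Lemma strace_tensor_op f g : strace (t f g) = strace f * strace g.
Proof.
elim/elem_ind: f => [|e f f' IH IH'|i j].
- by rewrite tensor_op0l !strace0 mul0r.
- by rewrite tensor_opDl tensor_opZl !straceD !straceZ IH IH' [RHS]mulrDl mulrA.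
elim/elem_ind: g => [|e g g' IH IH'|k l].
- by rewrite tensor_op0r !strace0 mulr0.
- rewrite tensor_opDr tensor_opZr !straceD !straceZ IH IH'.
  by rewrite [RHS]mulrDr mulrCA.
pose s : F := (-1) ^+ ((tag k (+) tag l) && tag j).
pose u : V := tens (hvec i) (hvec k).
rewrite (@strace_rank1 _ _ (s *: tcoord j l) u); last first.
  by move=> v; rewrite tensor_elemE scale_lfunE scalerA.
rewrite !(proj_part _ (tens_part (hvec_part i) (hvec_part k))).
rewrite !strace_elem1 !scale_lfunE mulrACA -signr_addb.
rewrite (_ : _ - _ = s * (-1) ^+ (tag i (+) tag k) * tcoord j l u).
  rewrite tcoord_tens !hcoord_vec [j == i]eq_sym [l == k]eq_sym.
  case: eqP => [ij|_]; last by rewrite !(mul0r, mulr0).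
  case: eqP => [kl|_]; last by rewrite !(mul0r, mulr0).
  by rewrite /s kl addbb mul1r.
case: (tag i (+) tag k) => /=; rewrite linear0.
  by rewrite scaler0 sub0r expr1 mulrN1 mulNr.
by rewrite scaler0 subr0 expr0 mulr1.
Qed.

(** [w] is the sum of its restrictions [w (E_jj (x) E_ll)] to the basis lines.
    Each of these has rank one, with image spanned by a vector that is a
    combination of the [e_i (x) e_k], so it is a combination of the
    [E_ij (x) E_kl]. *)
Lemma tensor_op_ind (P : 'End(V) -> Prop) :
    P 0 -> (forall (e : F) u v, P u -> P v -> P (e *: u + v)) ->
    (forall f g, P (t f g)) ->
  forall w, P w.
Proof.
move=> P0 Plin Pt w.
have -> : w = \sum_j \sum_l (w \o t (elem j j) (elem l l))%VF.
  rewrite -[LHS]comp_lfun1r -tensor_op1 -!sum_elem tensor_op_suml.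
  rewrite comp_lfun_sumr; apply: eq_bigr => j _.
  by rewrite tensor_op_sumr comp_lfun_sumr.
apply: (pred_sum P0 Plin) => j _; apply: (pred_sum P0 Plin) => l _.
have rank1 u : exists2 A : 'End(V), P A & forall v, A v = tcoord j l v *: u.
  move: u; apply: tens_linear_ind => [|e u u' [A PA AE] [A' PA' AE']|i k].
  - by exists 0 => // v; rewrite lfunE scaler0.
  - exists (e *: A + A'); first exact: Plin.
    by move=> v; rewrite add_lfunE scale_lfunE AE AE' scalerDr !scalerA mulrC.
  pose s : F := (-1) ^+ ((tag k (+) tag l) && tag j).
  exists (s *: t (elem i j) (elem k l) + 0); first exact: Plin.
  move=> v; rewrite addr0 scale_lfunE tensor_elemE !scalerA -expr2 sqrr_sign.
  by rewrite mul1r.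
have [A PA AE] := rank1 (w (tens (hvec j) (hvec l))).
suff -> : (w \o t (elem j j) (elem l l))%VF = A by [].
apply/lfunP => v; rewrite comp_lfunE AE tensor_elemE addbb scale1r.
by rewrite linearZ.
Qed.

Lemma tensor_op_decomp (w : 'End(V)) :
  exists W : hindex V1 -> hindex V1 -> 'End(V2),
    w = \sum_i \sum_j t (elem i j) (W i j).
Proof.
move: w; apply: tensor_op_ind => [|e w w' [W ->] [W' ->]|f g].
- exists (fun _ _ => 0); rewrite big1 // => i _; rewrite big1 // => j _.
  exact: tensor_op0r.
- exists (fun i j => e *: W i j + W' i j).
  rewrite scaler_sumr -big_split; apply: eq_bigr => i _.
  rewrite scaler_sumr -big_split; apply: eq_bigr => j _.
  by rewrite tensor_opDr tensor_opZr.
exists (fun i j => hcoord i (f (hvec j)) *: g).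
rewrite {1}(elem_sum f) tensor_op_suml; apply: eq_bigr => i _.
rewrite tensor_op_suml; apply: eq_bigr => j _.
by rewrite tensor_opZl tensor_opZr.
Qed.

(** Write [w] as the sum of the [E_ij (x) W_ij]. Pairing with [E_ba (x) g]
    isolates [W_ab], which is then orthogonal to [sl V2], that is, scalar, for
    [a <> b]; pairing with a diagonal element of [sl V1] does the same for the
    differences [W_aa - W_i0i0]. Subtracting [1 (x) W_i0i0] leaves a sum of
    terms [E_ij (x) 1]. *)
Lemma odot_of_sl_orthogonal i0 k0 (w : 'End(V)) :
    (forall f g, f \in sl V1 -> g \in sl V2 -> strace (w \o t f g) = 0) ->
  w \in odot (gl V1) (gl V2).
Proof.
move=> w0; have [W wE] := tensor_op_decomp w.
(* With f (x) g on the left of w, composition produces only a global sign in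
   each term, for homogeneous g. *)
have pair p q f g : homog p f -> homog q g -> f \in sl V1 -> g \in sl V2 ->
  \sum_i \sum_j ((-1) ^+ (q && (tag i (+) tag j)) *
     ((-1) ^+ tag j * hcoord j (f (hvec i)) * strace (g \o W i j)) : F) = 0.
  move=> fp gq fsl gsl; transitivity (strace (t f g \o w) : F); last first.
    by rewrite (straceC w (homog_tensor_op fp gq)) w0 // mulr0.
  apply/esym; rewrite wE comp_lfun_sumr strace_sum.
  apply: eq_bigr => i _; rewrite comp_lfun_sumr strace_sum.
  apply: eq_bigr => j _ /=.
  rewrite (tensor_op_comp _ _ gq (homog_elem i j)) straceZ strace_tensor_op.
  by rewrite strace_elem.
have offd a b : a != b -> exists c, W a b = c *: \1%VF.
  move=> ab; eexists; apply: (scalar_of_sl_orthogonal k0) => q g gq gsl.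
  have ba : b != a by rewrite eq_sym.
  have := pair _ _ _ _ (homog_elem b a) gq (elem_sl ba) gsl.
  rewrite (bigD1 a) //= (bigD1 b) //= !big1 ?addr0; first last.
  - move=> j jb; rewrite elem_vec linearZ /= hcoord_vec (negPf jb).
    by rewrite scaler0 mulr0 mul0r mulr0.
  - move=> i ia; rewrite big1 // => j _.
    by rewrite elem_vec eq_sym (negPf ia) scale0r linear0 mulr0 mul0r mulr0.
  rewrite elem_vec eqxx scale1r hcoord_vec eqxx mulr1 => /eqP.
  by rewrite !mulf_eq0 !signr_eq0 => /eqP.
have diag a : exists c, W a a - W i0 i0 = c *: \1%VF.
  eexists; apply: (scalar_of_sl_orthogonal k0) => q g gq gsl.
  have ev :
      homog false ((-1) ^+ tag a *: elem a a - (-1) ^+ tag i0 *: elem i0 i0).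
    by apply: homogB; apply/homogZ/even_elem.
  rewrite -[RHS](pair _ _ _ _ ev gq (elem_sdiff_sl a i0) gsl).
  rewrite comp_lfunDr comp_lfunNr straceB.
  have term b : strace (g \o W b b) =
      \sum_i \sum_j ((-1) ^+ (q && (tag i (+) tag j)) *
        ((-1) ^+ tag j * hcoord j (((-1) ^+ tag b *: elem b b) (hvec i))
         * strace (g \o W i j)) : F).
    rewrite (bigD1 b) //= (bigD1 b) //= !big1 ?addr0; first last.
    - move=> j jb; rewrite scale_lfunE elem_vec !linearZ /= hcoord_vec.
      by rewrite (negPf jb) !scaler0 mulr0 mul0r mulr0.
    - move=> i ib; rewrite big1 // => j _.
      rewrite scale_lfunE elem_vec eq_sym (negPf ib) scale0r !linear0.
      by rewrite mulr0 mul0r mulr0.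
    rewrite scale_lfunE elem_vec eqxx scale1r linearZ /= hcoord_vec eqxx.
    rewrite addbb andbF mul1r.
    by rewrite [_ *: _]mulr1 -expr2 sqrr_sign mul1r.
  rewrite !term -sumrB; apply: eq_bigr => i _.
  rewrite -sumrB; apply: eq_bigr => j _.
  by rewrite add_lfunE opp_lfunE linearB /= -mulrBr -mulrBl -mulrBr.
have inl f : t f \1%VF \in odot (gl V1) (gl V2).
  by apply/mem_odotP; exists f, 0; rewrite !memvf tensor_op0r addr0.
have inr g : t \1%VF g \in odot (gl V1) (gl V2).
  by apply/mem_odotP; exists 0, g; rewrite !memvf tensor_op0l add0r.
have -> : w = (\sum_i t (elem i i) (W i i - W i0 i0)
    + \sum_i \sum_(j | j != i) t (elem i j) (W i j)) + t \1%VF (W i0 i0).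
  rewrite wE -sum_elem tensor_op_suml [RHS]addrAC -!big_split /=.
  apply: eq_bigr => i _; rewrite (bigD1 i) //= -tensor_opDr.
  by rewrite subrK.
rewrite !memvD ?inr //; apply: memv_suml => i _.
  by have [c ->] := diag i; rewrite tensor_opZr memvZ.
apply: memv_suml => j ji; have [|c ->] := offd i j; first by rewrite eq_sym.
by rewrite tensor_opZr memvZ.
Qed.

End TensorElementary.


(** * Subalgebras containing both special linear algebras *)

Section Dichotomy.
Variables (F : fieldType) (V1 V2 : superspace F).
Local Notation V := (tensor V1 V2).
Local Notation t := (@tensor_op F V1 V2).

Hypothesis two_neq0 : (2 : F) != 0.
Variables (i j : hindex V1) (k l : hindex V2).
Hypotheses (ij : i != j) (tij : tag i = tag j).
Hypotheses (kl : k != l) (tkl : tag k = tag l).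

Lemma sl_complement (W : superspace F) (z g : 'End(W)) : strace z != 0 ->
  g - (strace g / strace z) *: z \in sl W.
Proof. by move=> z0; rewrite mem_sl straceB straceZ mulfVK // subrr. Qed.

(** [sl_generated] in the first factor, with the second one fixed. It is
    applied both to membership in [K] and to orthogonality to [K]. *)
Lemma generate_left (P : 'End(V) -> Prop) g : P 0 ->
    (forall (c : F) u v, P u -> P v -> P (c *: u + v)) ->
    (forall a b w, a != b -> P w -> P (sbracket (t (elem a b) \1%VF) w)) ->
    P (t (elem i j) g) ->
  forall f, f \in sl V1 -> P (t f g).
Proof.
move=> P0 Plin Pad Pij.
apply: (sl_generated two_neq0 _ _ _ ij tij Pij) => [|c u v Pu Pv|a b f ab Pf].
- by rewrite tensor_op0l.
- by rewrite tensor_opDl tensor_opZl; apply: Plin.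
by rewrite -sbracket_tensorl; apply: Pad.
Qed.

Lemma generate_right (P : 'End(V) -> Prop) p f : P 0 ->
    (forall (c : F) u v, P u -> P v -> P (c *: u + v)) ->
    (forall a b w, a != b -> P w -> P (sbracket (t \1%VF (elem a b)) w)) ->
    homog p f -> P (t f (elem k l)) ->
  forall g, g \in sl V2 -> P (t f g).
Proof.
move=> P0 Plin Pad fp Pkl.
apply: (sl_generated two_neq0 _ _ _ kl tkl Pkl) => [|c u v Pu Pv|a b g ab Pg].
- by rewrite tensor_op0r.
- by rewrite tensor_opDr tensor_opZr; apply: Plin.
have := Pad _ _ _ ab Pg; rewrite (sbracket_tensorr _ (homog_elem a b) fp).
set e := _ ^+ _ => Pe; rewrite -[t f _]addr0 -[t f _]scale1r.
by rewrite -(sqrr_sign F ((tag a (+) tag b) && p)) expr2 -scalerA; apply: Plin.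
Qed.

Variable K : {vspace 'End(V)}.
Hypothesis Ksub : lie_subsuperalgebra K.
Hypothesis slK : (odot (sl V1) (sl V2) <= K)%VS.

Lemma memK_left f : f \in sl V1 -> t f \1%VF \in K.
Proof.
move=> fsl; apply: (subvP slK); apply/mem_odotP; exists f, 0.
by rewrite fsl mem0v tensor_op0r addr0.
Qed.

Lemma memK_right g : g \in sl V2 -> t \1%VF g \in K.
Proof.
move=> gsl; apply: (subvP slK); apply/mem_odotP; exists 0, g.
by rewrite gsl mem0v tensor_op0l add0r.
Qed.

Lemma memK_bracket u v : u \in K -> v \in K -> sbracket u v \in K.
Proof. exact: (proj2 Ksub). Qed.

Lemma memK_lin (c : F) u v : u \in K -> v \in K -> c *: u + v \in K.
Proof. by move=> uK vK; rewrite memvD ?memvZ. Qed.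

Lemma memK_adl (a b : hindex V1) w : a != b -> w \in K ->
  sbracket (t (elem a b) \1%VF) w \in K.
Proof. by move=> ab; apply/memK_bracket/memK_left/elem_sl. Qed.

Lemma memK_adr (a b : hindex V2) w : a != b -> w \in K ->
  sbracket (t \1%VF (elem a b)) w \in K.
Proof. by move=> ab; apply/memK_bracket/memK_right/elem_sl. Qed.

Local Notation X := (elem i j).
Local Notation Y := (elem k l).
Local Notation Z := (t X Y).

Let X0 : homog false X := even_elem tij.
Let Y0 : homog false Y := even_elem tkl.

Lemma sub_odot_of_orthogonal :
  (forall w, w \in K -> strace (w \o Z) = 0) -> (K <= odot (gl V1) (gl V2))%VS.
Proof.
move=> KZ; apply/subvP => w wK.
apply: (odot_of_sl_orthogonal i k) => f g fsl gsl.
pose P (s : 'End(V)) := forall w, w \in K -> strace (w \o s) = 0.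
have P0 : P 0 by move=> u _; rewrite comp_lfun0r strace0.
have Plin (c : F) u v : P u -> P v -> P (c *: u + v).
  move=> Pu Pv x xK; rewrite comp_lfunDr -comp_lfunZr straceD straceZ.
  by rewrite Pu // Pv // mulr0 addr0.
have Pad m s : m \in K -> P s -> P (sbracket m s).
  by move=> mK Ps x xK; rewrite -strace_invariant; apply/Ps/memK_bracket.
suff : P (t f g) by apply.
apply: (generate_left P0 Plin _ _ fsl) => [a b s ab|].
  exact/Pad/memK_left/elem_sl.
apply: (generate_right P0 Plin _ X0 _ gsl) => [a b s ab|//].
  exact/Pad/memK_right/elem_sl.
Qed.

(** By [ad2_nilpotent] in each factor, [4 Z w Z] lies in [K], and
    [Z w Z = c Z] because [Z] has rank one. Here [c] is not zero, since
    [str (w Z)] is the supertrace of [(E_ji (x) E_lk) Z w Z]. *)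
Lemma elem_tensor_mem w : w \in K -> strace (w \o Z) != 0 -> Z \in K.
Proof.
move=> wK wZ.
have ji : (j == i) = false by rewrite eq_sym (negPf ij).
have lk : (l == k) = false by rewrite eq_sym (negPf kl).
have ev1 : homog false (t X \1%VF) by exact: homog_tensor_op X0 (@homog1 _ _).
have ev2 : homog false (t \1%VF Y) by exact: homog_tensor_op (@homog1 _ _) Y0.
have XX : (t X \1%VF \o t X \1%VF)%VF = 0.
  by rewrite tensor_op_comp_even // elem_comp ji scale0r tensor_op0l.
have YY : (t \1%VF Y \o t \1%VF Y)%VF = 0.
  rewrite tensor_op_comp_even; last exact: homog1.
  by rewrite elem_comp lk scale0r tensor_op0r.
have ZwZ_K : (Z \o w \o Z)%VF \in K.
  have := memK_adr kl (memK_adr kl (memK_adl ij (memK_adl ij wK))).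
  rewrite (ad2_nilpotent _ ev1 XX) (ad2_nilpotent _ ev2 YY).
  have -> : (t \1%VF Y \o (- (t X \1%VF \o w \o t X \1%VF)%VF *+ 2)
               \o t \1%VF Y)%VF =
      - (Z \o w \o Z)%VF *+ 2.
    rewrite mulr2n comp_lfunDr comp_lfunDl comp_lfunNr comp_lfunNl -mulr2n.
    rewrite !comp_lfunA tensor_op_comp_even // -!comp_lfunA.
    rewrite tensor_op_comp_even; last exact: homog1.
    by rewrite !comp_lfun1l !comp_lfun1r.
  rewrite -mulNrn opprK -mulrnA -scaler_nat => /(memvZ ((2 * 2)%N%:R^-1)).
  by rewrite scalerA mulVf ?scale1r // natrM mulf_neq0.
pose c : F := tcoord j l (w (tens (hvec i) (hvec k))).
have ZE v : Z v = tcoord j l v *: tens (hvec i) (hvec k).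
  by rewrite tensor_elemE tkl addbb scale1r.
have ZwZ : (Z \o w \o Z)%VF = c *: Z.
  by apply/lfunP => v; rewrite scale_lfunE !comp_lfunE (ZE v) !linearZ /= ZE.
suff c0 : c != 0.
  by have := memvZ c^-1 ZwZ_K; rewrite ZwZ scalerA mulVf // scale1r.
apply: contraNneq wZ => c0; rewrite c0 scale0r in ZwZ.
pose D := t (elem j j) (elem l l).
have ZD : (Z \o D)%VF = Z.
  by rewrite tensor_op_comp_even ?elem_comp ?eqxx ?scale1r //; apply: even_elem.
have DZ : D = (t (elem j i) (elem l k) \o Z)%VF.
  by rewrite tensor_op_comp_even ?elem_comp ?eqxx ?scale1r.
have D0 : homog false D by exact: homog_tensor_op (even_elem _) (even_elem _).
rewrite -ZD comp_lfunA -[strace _]mul1r -(straceC _ D0) DZ -comp_lfunA.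
by rewrite comp_lfunA -!comp_lfunA (comp_lfunA Z) ZwZ comp_lfun0r strace0.
Qed.

Hypothesis ZK : Z \in K.

Lemma sl_sl_mem f g : f \in sl V1 -> g \in sl V2 -> t f g \in K.
Proof.
move=> fsl gsl; apply: (generate_left (mem0v K) memK_lin memK_adl _ fsl).
exact: (generate_right (mem0v K) memK_lin memK_adr X0 ZK gsl).
Qed.

Lemma strace_sum_diag (W : superspace F) (a b : hindex W) :
  tag a = tag b -> strace (elem a a + elem b b) != 0.
Proof.
move=> ab; rewrite straceD !strace_elem1 !eqxx ab !mulr1 -mulr2n -mulr_natr.
by rewrite mulf_neq0 ?signr_eq0.
Qed.

(** The bracket of [Z] with [(E_ii - E_jj) (x) E_lk] is
    [- X (x) (E_kk + E_ll)]: the anticommutator of [E_kl] and [E_lk], which is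
    not in [sl V2], appears since [E_ii - E_jj] anticommutes with [X]. *)
Lemma sl_gl_mem f g : f \in sl V1 -> t f g \in K.
Proof.
have ji : j != i by rewrite eq_sym. have lk : l != k by rewrite eq_sym.
have XzK : t X (elem k k + elem l l) \in K.
  have := memK_bracket ZK (sl_sl_mem (elem_diff_sl tij) (elem_sl lk)).
  have H0 : homog false (elem i i - elem j j).
    by apply: homogB; apply: even_elem.
  rewrite sbracket_even; last exact: homog_tensor_op X0 Y0.
  rewrite !tensor_op_comp_even // comp_lfunDl comp_lfunDr.
  rewrite comp_lfunNl comp_lfunNr.
  rewrite !elem_comp !eqxx (negPf ji) !scale0r !scale1r sub0r subr0.
  by rewrite -scaleN1r tensor_opZl scaleN1r -opprD -tensor_opDr memvN.
move=> fsl; apply: (generate_left (mem0v K) memK_lin memK_adl _ fsl).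
have gE := sl_complement g (strace_sum_diag tkl).
set z := elem k k + elem l l in XzK gE *.
rewrite -[g](subrK ((strace g / strace z) *: z)).
rewrite tensor_opDr; apply: memvD; first exact: sl_sl_mem (elem_sl ij) gE.
by rewrite tensor_opZr memvZ.
Qed.

Lemma gl_sl_mem f g : g \in sl V2 -> t f g \in K.
Proof.
have ji : j != i by rewrite eq_sym. have lk : l != k by rewrite eq_sym.
have zYK : t (elem i i + elem j j) Y \in K.
  have := memK_bracket ZK (sl_sl_mem (elem_sl ji) (elem_diff_sl tkl)).
  have ev : homog false (elem j i) by apply: even_elem.
  rewrite sbracket_even; last exact: homog_tensor_op X0 Y0.
  rewrite !tensor_op_comp_even // comp_lfunDl comp_lfunDr.
  rewrite comp_lfunNl comp_lfunNr.
  rewrite !elem_comp !eqxx (negPf lk) !scale0r !scale1r sub0r subr0.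
  by rewrite -scaleN1r tensor_opZr scaleN1r -opprD -tensor_opDl memvN.
move=> gsl; elim/homog_ind: f => [f f' IH IH'|p f fp].
  by rewrite tensor_opDl memvD.
apply: (generate_right (mem0v K) memK_lin memK_adr fp _ gsl).
have fE := sl_complement f (strace_sum_diag tij).
set z := elem i i + elem j j in zYK fE *.
rewrite -[f](subrK ((strace f / strace z) *: z)).
rewrite tensor_opDl; apply: memvD; first exact: sl_sl_mem fE (elem_sl kl).
by rewrite tensor_opZl memvZ.
Qed.

(** Modulo [sl V1 (x) gl V2 + gl V1 (x) sl V2], which lies in [K] and in [sl V],
    every operator is a multiple of one [z1 (x) z2] of nonzero supertrace. *)
Lemma sl_sub_of_elem_tensor : (sl V <= K)%VS.
Proof.
pose z1 := elem i i + elem j j; pose z2 := elem k k + elem l l.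
have z10 : strace z1 != 0 := strace_sum_diag tij.
have z20 : strace z2 != 0 := strace_sum_diag tkl.
pose P w := exists2 c, w - c *: t z1 z2 \in K & strace (w - c *: t z1 z2) = 0.
have Pw : forall w, P w.
  apply: tensor_op_ind => [|e u v [c uK u0] [d vK v0]|f g].
  - by exists 0; rewrite scale0r subr0 ?mem0v ?strace0.
  - have E : e *: u + v - (e * c + d) *: t z1 z2 =
        e *: (u - c *: t z1 z2) + (v - d *: t z1 z2).
      by rewrite scalerBr scalerA scalerDl opprD addrACA.
    exists (e * c + d); rewrite E ?memK_lin //.
    by rewrite straceD straceZ u0 v0 mulr0 addr0.
  pose a := strace f / strace z1; pose b := strace g / strace z2.
  have fsl : f - a *: z1 \in sl V1 := sl_complement f z10.
  have gsl : g - b *: z2 \in sl V2 := sl_complement g z20.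
  have E : t f g - (a * b) *: t z1 z2 =
      t (f - a *: z1) g + a *: t z1 (g - b *: z2).
    rewrite tensor_opBl tensor_opBr tensor_opZl tensor_opZr scalerBr scalerA.
    by rewrite addrA subrK.
  exists (a * b); rewrite E.
    by rewrite memvD ?sl_gl_mem ?memvZ ?gl_sl_mem.
  move: fsl gsl; rewrite !mem_sl => /eqP f0 /eqP g0.
  by rewrite straceD straceZ !strace_tensor_op f0 g0 mul0r !mulr0 addr0.
apply/subvP => w; rewrite mem_sl => /eqP w0; have [c wK] := Pw w.
rewrite straceB straceZ w0 strace_tensor_op sub0r => /eqP.
rewrite oppr_eq0 !mulf_eq0 (negPf z10) (negPf z20) !orbF => /eqP c0.
by move: wK; rewrite c0 scale0r subr0.
Qed.



End Dichotomy.

(** * Maximality *)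

Section Maximality.
Variables (F : fieldType) (V1 V2 : superspace F).
Local Notation V := (tensor V1 V2).
Local Notation t := (@tensor_op F V1 V2).
Hypothesis two_neq0 : (2 : F) != 0.
Variables (i j : hindex V1) (k l : hindex V2).
Hypotheses (ij : i != j) (tij : tag i = tag j).
Hypotheses (kl : k != l) (tkl : tag k = tag l).

(** The two cases are told apart by whether [E_ij (x) E_kl] is orthogonal to
    [K]. *)
Lemma subalgebra_dichotomy (K : {vspace 'End(V)}) : lie_subsuperalgebra K ->
    (odot (sl V1) (sl V2) <= K)%VS ->
  (K <= odot (gl V1) (gl V2))%VS \/ (sl V <= K)%VS.
Proof.
move=> Ksub slK; pose Z := t (elem i j) (elem k l).
have [/allP KZ|/allPn[w wK wZ]] :=
    boolP (all (fun w : 'End(V) => strace (w \o Z) == 0) (vbasis K)).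
  left; apply: (sub_odot_of_orthogonal two_neq0 ij tij kl tkl Ksub slK) => w wK.
  rewrite (coord_vbasis wK) comp_lfun_suml strace_sum big1 // => n _.
  rewrite -comp_lfunZl straceZ.
  by rewrite (eqP (KZ _ _)) ?mulr0 // mem_nth // size_tuple.
right; apply: (sl_sub_of_elem_tensor two_neq0 ij tij kl tkl Ksub slK).
exact: (elem_tensor_mem two_neq0 ij tij kl tkl Ksub slK (vbasis_mem wK) wZ).
Qed.

(** [E_ij (x) E_kl] pairs to a nonzero value with [E_ji (x) E_lk], which is
    orthogonal to [gl V1 (.) gl V2]. *)
Lemma sl_not_sub_odot : ~ (sl V <= odot (gl V1) (gl V2))%VS.
Proof.
have ji : j != i by rewrite eq_sym.
have lk : l != k by rewrite eq_sym.
have Zsl : t (elem i j) (elem k l) \in sl V.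
  by rewrite mem_sl strace_tensor_op !strace_elem1 (negPf ij) mulr0 mul0r.
move/subvP/(_ _ Zsl)/mem_odotP=> [f [g [_ _ ZE]]].
have := congr1 (fun w : 'End(V) => strace (w \o t (elem j i) (elem l k))) ZE.
have ev a b : tag a = tag b -> homog false (elem a b : 'End(V1)).
  exact: even_elem.
rewrite comp_lfunDl !tensor_op_comp_even; try exact: ev.
rewrite !comp_lfun1l !elem_comp !eqxx !scale1r straceD !strace_tensor_op.
rewrite !strace_elem1 (negPf ji) (negPf lk) !eqxx !(mulr0, mul0r) addr0 !mulr1.
by move/eqP; rewrite mulf_eq0 !signr_eq0.
Qed.

Lemma gl_subsuperalgebra (W : superspace F) : lie_subsuperalgebra (gl W).
Proof. by split=> *; apply: memvf. Qed.

Lemma sl_subsuperalgebra (W : superspace F) : lie_subsuperalgebra (sl W).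
Proof.
split=> [p f|f g _ _]; rewrite !mem_sl ?strace_sbracket // strace_hcomp.
by case: p.
Qed.

Local Notation str1 W := (strace (\1%VF : 'End(W))).

Lemma mem_odot_gl_l f : t f \1%VF \in odot (gl V1) (gl V2).
Proof. by apply/mem_odotP; exists f, 0; rewrite !memvf tensor_op0r addr0. Qed.

Lemma mem_odot_gl_r g : t \1%VF g \in odot (gl V1) (gl V2).
Proof. by apply/mem_odotP; exists 0, g; rewrite !memvf tensor_op0l add0r. Qed.

Lemma odotS (L1 M1 : {vspace 'End(V1)}) (L2 M2 : {vspace 'End(V2)}) :
  (L1 <= M1 -> L2 <= M2 -> odot L1 L2 <= odot M1 M2)%VS.
Proof. by move=> L M; apply: addvS; apply: limgS. Qed.

Lemma odot_gl_maximal_gl : str1 V1 != 0 \/ str1 V2 != 0 ->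
  maximal_subalgebra (odot (gl V1) (gl V2)) (gl V).
Proof.
move=> str_neq0; split.
- exact/odot_subsuperalgebra/gl_subsuperalgebra/gl_subsuperalgebra.
- exact: subvf.
- by move=> E; apply: sl_not_sub_odot; rewrite E subvf.
move=> K Ksub MK _; have [KM|slK] :=
    subalgebra_dichotomy Ksub (subv_trans (odotS (subvf _) (subvf _)) MK).
  by left; apply/eqP; rewrite eqEsubv KM MK.
right; apply/eqP; rewrite eqEsubv subvf /=; apply/subvP => w _.
have [z zK z0] : exists2 z, z \in K & strace z != 0.
  case: str_neq0 => s0.
    exists (t \1%VF (elem k k)); first exact/(subvP MK)/mem_odot_gl_r.
    by rewrite strace_tensor_op strace_elem1 eqxx mulr1 mulf_neq0 ?signr_eq0.
  exists (t (elem i i) \1%VF); first exact/(subvP MK)/mem_odot_gl_l.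
  by rewrite strace_tensor_op strace_elem1 eqxx mulr1 mulf_neq0 ?signr_eq0.
rewrite -[w](subrK ((@strace F V w / strace z) *: z)) memvD ?memvZ //.
exact/(subvP slK)/sl_complement.
Qed.

Lemma odot_gl_maximal_sl : str1 V1 = 0 -> str1 V2 = 0 ->
  maximal_subalgebra (odot (gl V1) (gl V2)) (sl V).
Proof.
move=> s1 s2; split.
- exact/odot_subsuperalgebra/gl_subsuperalgebra/gl_subsuperalgebra.
- apply/subvP => _ /mem_odotP[f [g [_ _ ->]]].
  by rewrite mem_sl straceD !strace_tensor_op s1 s2 mulr0 mul0r addr0.
- by move=> E; apply: sl_not_sub_odot; rewrite E.
move=> K Ksub MK Ksl; have [KM|slK] :=
    subalgebra_dichotomy Ksub (subv_trans (odotS (subvf _) (subvf _)) MK).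
  by left; apply/eqP; rewrite eqEsubv KM MK.
by right; apply/eqP; rewrite eqEsubv Ksl slK.
Qed.

(** An element [f (x) 1 + 1 (x) g] only determines [f] and [g] up to moving a
    scalar from one to the other. If [str 1] is nonzero on [V1], say, a scalar
    can be moved so that [f] has supertrace zero, and then so has [g]. *)
Lemma odot_gl_cap_sl : str1 V1 != 0 \/ str1 V2 != 0 ->
  (odot (gl V1) (gl V2) :&: sl V <= odot (sl V1) (sl V2))%VS.
Proof.
move=> str_neq0; apply/subvP => w; rewrite memv_cap.
move=> /andP[/mem_odotP[f [g [_ _ ->]]]].
rewrite mem_sl straceD !strace_tensor_op => /eqP w0; apply/mem_odotP.
case: str_neq0 => s0.
  pose a := strace f / str1 V1; exists (f - a *: \1%VF), (g + a *: \1%VF).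
  split; first exact: sl_complement.
    rewrite mem_sl straceD straceZ -(inj_eq (mulfI s0)) mulr0 mulrDr addrC.
    by rewrite mulrA [str1 V1 * a]mulrC mulfVK // w0.
  rewrite tensor_opBl tensor_opDr tensor_opZl tensor_opZr.
  by rewrite addrACA addNr addr0.
pose a := strace g / str1 V2; exists (f + a *: \1%VF), (g - a *: \1%VF).
split; last first.
- rewrite tensor_opBr tensor_opDl tensor_opZl tensor_opZr.
  by rewrite addrACA addrN addr0.
- exact: sl_complement.
rewrite mem_sl straceD straceZ -(inj_eq (mulIf s0)) mul0r mulrDl.
by rewrite mulrAC mulfVK // [strace g * _]mulrC w0.
Qed.

Lemma odot_sl_maximal : str1 V1 != 0 \/ str1 V2 != 0 ->
  maximal_subalgebra (odot (sl V1) (sl V2)) (sl V).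
Proof.
move=> str_neq0; split.
- exact/odot_subsuperalgebra/sl_subsuperalgebra/sl_subsuperalgebra.
- apply/subvP => _ /mem_odotP[f [g [+ + ->]]].
  rewrite !mem_sl straceD !strace_tensor_op => /eqP-> /eqP->.
  by rewrite mulr0 mul0r addr0.
- by move=> E; apply: sl_not_sub_odot; rewrite -E odotS ?subvf.
move=> K Ksub MK Ksl; have [KM|slK] := subalgebra_dichotomy Ksub MK.
  left; apply/eqP; rewrite eqEsubv MK andbT.
  by apply: subv_trans (odot_gl_cap_sl str_neq0); rewrite subv_cap KM Ksl.
by right; apply/eqP; rewrite eqEsubv Ksl slK.
Qed.

End Maximality.

Lemma strace_id (F : fieldType) (V : superspace F) :
  strace (\1%VF : 'End(V)) = (sdim V).1%:R - (sdim V).2%:R.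
Proof.
rewrite -sum_elem strace_sum.
transitivity (\sum_(p : bool) \sum_(m < \dim (part V p)) (-1) ^+ p : F).
  rewrite sig_big_dep; apply: eq_bigr => i _.
  by rewrite strace_elem1 eqxx mulr1.
by rewrite big_bool !sumr_const !card_ord /= addrC mulNrn.
Qed.

(** The four excluded dimensions are those with at most one basis vector of
    each parity. *)
Lemma same_parity_pair (F : fieldType) (V : superspace F) m n :
    sdim V = (m, n) -> (m, n) <> (0, 0)%N -> (m, n) <> (1, 0)%N ->
    (m, n) <> (0, 1)%N -> (m, n) <> (1, 1)%N ->
  exists i j : hindex V, i != j /\ tag i = tag j.
Proof.
move=> [dm dn] n00 n10 n01 n11.
have [p dp] : exists p, (1 < \dim (part V p))%N.
  have [m1|m1] := ltnP 1 m; first by exists false; rewrite dm.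
  exists true; rewrite dn ltnNge; apply/negP => n1.
  by case: m n m1 n1 n00 n10 n01 n11 {dm dn} => [|[|m]] [|[|n]].
pose mk x : hindex V := existT (fun p => 'I_(\dim (part V p))) p x.
exists (mk (Ordinal (ltnW dp))), (mk (Ordinal dp)); split=> //.
by rewrite eq_Tagged.
Qed.

Theorem theorem2p1 (R : realType) (V1 V2 : superspace R[i])
    (m1 n1 m2 n2 : nat)
    (dimV1 : sdim V1 = (m1, n1)) (dimV2 : sdim V2 = (m2, n2))
    (V1_neq0 : (m1, n1) <> (0%N, 0%N)) (V2_neq0 : (m2, n2) <> (0%N, 0%N))
    (N1_neq1 : (m1, n1) <> (1%N, 0%N)) (N2_neq1 : (m2, n2) <> (1%N, 0%N))
    (N1_neqe : (m1, n1) <> (0%N, 1%N)) (N2_neqe : (m2, n2) <> (0%N, 1%N))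
    (N1_neq1e : (m1, n1) <> (1%N, 1%N)) (N2_neq1e : (m2, n2) <> (1%N, 1%N)) :
  let V := tensor V1 V2 in
  ((n1 <> m1 \/ n2 <> m2 ->
      maximal_subalgebra (odot (gl V1) (gl V2)) (gl V)) /\
   (~ (n1 <> m1 \/ n2 <> m2) ->
      maximal_subalgebra (odot (gl V1) (gl V2)) (sl V))) /\
  ((n1 <> m1 \/ n2 <> m2 ->
      maximal_subalgebra (odot (sl V1) (sl V2)) (sl V)) /\
   (n1 = m1 /\ n2 = m2 ->
      maximal_subalgebra (odot (gl V1) (gl V2)) (sl V))).
Proof.
move=> V.
have two0 : (2 : R[i]) != 0 by rewrite pnatr_eq0.
have [i [j [ij tij]]] :=
  same_parity_pair dimV1 V1_neq0 N1_neq1 N1_neqe N1_neq1e.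
have [k [l [kl tkl]]] :=
  same_parity_pair dimV2 V2_neq0 N2_neq1 N2_neqe N2_neq1e.
have neq0 (W : superspace R[i]) m n : sdim W = (m, n) -> n <> m ->
    strace (\1%VF : 'End(W)) != 0.
  move=> dW nm; rewrite strace_id dW /= subr_eq0 eqr_nat.
  by apply/eqP => mn; apply: nm.
have eq0 (W : superspace R[i]) m n : sdim W = (m, n) -> n = m ->
    strace (\1%VF : 'End(W)) = 0.
  by move=> dW nm; rewrite strace_id dW nm /= subrr.
have str_neq0 : n1 <> m1 \/ n2 <> m2 ->
    strace (\1%VF : 'End(V1)) != 0 \/ strace (\1%VF : 'End(V2)) != 0.
  by case=> [/(neq0 _ _ _ dimV1)|/(neq0 _ _ _ dimV2)]; [left|right].
have max_sl : n1 = m1 -> n2 = m2 ->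
    maximal_subalgebra (odot (gl V1) (gl V2)) (sl V).
  move=> e1 e2; apply: (odot_gl_maximal_sl two0 ij tij kl tkl).
    exact: eq0 dimV1 e1.
  exact: eq0 dimV2 e2.
split; split.
- by move/str_neq0; apply: (odot_gl_maximal_gl two0 ij tij kl tkl).
- move=> eqs; apply: max_sl; apply/eqP; apply: contra_notT eqs => /eqP;
    by [left|right].
- by move/str_neq0; apply: (odot_sl_maximal two0 ij tij kl tkl).
by case; apply: max_sl.
Qed.
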